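(* The reflection $H\vdash I:2Cat\rightarrow 2Preord$ has a monotone-light factorization; that is, the pair $(\mathcal{E}'_I,\mathcal{M}^*_I)$ of classes of 2-functors, obtained by stabilizing $\mathcal{E}_I$ and localizing $\mathcal{M}_I$, is a factorization system on $2Cat$.
   Context: $2Cat$ is the category of all (small, strict) 2-categories and 2-functors. $2Preord$ is its full subcategory of 2-preorders, i.e. those 2-categories in which any two 2-cells with the same vertical domain and the same vertical codomain are equal. $H:2Preord\to 2Cat$ is the full inclusion; its left adjoint $I$ keeps objects and 1-cells and identifies all 2-cells having the same vertical domain and the same vertical codomain. The unit is $\eta:1_{2Cat}\to HI$. $\mathcal{E}_I$ is the class of 2-functors $f$ such that $I(f)$ is an isomorphism. $\mathcal{M}_I$ (trivial coverings) is the class of 2-functors $f:A\to B$ for which the naturality square $HI(f)\circ\eta_A=\eta_B\circ f$ is a pullback. $\mathcal{E}'_I$ is the largest subclass of $\mathcal{E}_I$ stable under pullbacks: $f:A\to B$ is in $\mathcal{E}'_I$ iff for every 2-functor $g:C\to B$ the projection $C\times_B A\to C$ is in $\mathcal{E}_I$. $\mathcal{M}^*_I$ (coverings) is the class of 2-functors $f:A\to B$ for which there exists an effective descent morphism $p:C\to B$ in $2Cat$ such that the projection $p^*(f):C\times_BA\to C$ is in $\mathcal{M}_I$. A morphism $p:C\to B$ in $2Cat$ is an effective descent morphism if the pullback functor $p^*:2Cat/B\to 2Cat/C$ is monadic. A factorization system $(\mathcal{E},\mathcal{M})$ on a category consists of two classes of morphisms, each containing the isomorphisms and closed under composition, such that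 every morphism $f$ factors as $f=m\circ e$ with $e\in\mathcal{E}$, $m\in\mathcal{M}$, and for every commutative square $m\circ u=v\circ e$ with $e\in\mathcal{E}$ and $m\in\mathcal{M}$ there is a unique $w$ with $w\circ e=u$ and $m\circ w=v$. *)

(* Defs.v *)
From Stdlib Require Import FunctionalExtensionality ClassicalEpsilon.

Set Implicit Arguments.
Unset Strict Implicit.

Declare Scope cat_scope.
Delimit Scope cat_scope with cat.
Local Open Scope cat_scope.

Record Category : Type := {
  Ob :> Type;
  Hom : Ob -> Ob -> Type;
  idm : forall a, Hom a a;
  comp : forall a b c, Hom b c -> Hom a b -> Hom a c;
  comp_assoc : forall a b c d (h : Hom c d) (g : Hom b c) (f : Hom a b),
    comp h (comp g f) = comp (comp h g) f;
  comp_idl : forall a b (f : Hom a b), comp (idm b) f = f;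
  comp_idr : forall a b (f : Hom a b), comp f (idm a) = f
}.

Arguments Hom {_} _ _.
Arguments idm {_} _.
Arguments comp {_ _ _ _} _ _.
Notation "g ∘ f" := (comp g f) (at level 40, left associativity) : cat_scope.

Definition is_iso (C : Category) (a b : C) (f : Hom a b) : Prop :=
  exists g : Hom b a, g ∘ f = idm a /\ f ∘ g = idm b.

Record Functor (C D : Category) : Type := {
  fob :> C -> D;
  fmap : forall a b, Hom a b -> Hom (fob a) (fob b);
  fmap_id : forall a, fmap (idm a) = idm (fob a);
  fmap_comp : forall a b c (g : Hom b c) (f : Hom a b),
    fmap (g ∘ f) = fmap g ∘ fmap f
}.

Arguments fmap {C D} _ {a b} _.

Definition id_functor (C : Category) : Functor C C :=
  {| fob := fun a => a;
     fmap := fun _ _ f => f;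
     fmap_id := fun _ => eq_refl;
     fmap_comp := fun _ _ _ _ _ => eq_refl |}.

Lemma comp_functor_id (C D E : Category) (G : Functor D E) (F : Functor C D) a :
  fmap G (fmap F (idm a)) = idm (G (F a)).
Proof. now rewrite !fmap_id. Qed.

Lemma comp_functor_comp (C D E : Category) (G : Functor D E) (F : Functor C D)
  a b c (g : Hom b c) (f : Hom a b) :
  fmap G (fmap F (g ∘ f)) = fmap G (fmap F g) ∘ fmap G (fmap F f).
Proof. now rewrite !fmap_comp. Qed.

Definition comp_functor (C D E : Category) (G : Functor D E) (F : Functor C D) :
  Functor C E :=
  {| fob := fun a => G (F a);
     fmap := fun _ _ f => fmap G (fmap F f);
     fmap_id := comp_functor_id G F;
     fmap_comp := @comp_functor_comp _ _ _ G F |}.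

Record NatTrans (C D : Category) (F G : Functor C D) : Type := {
  component :> forall a, Hom (F a) (G a);
  naturality : forall a b (f : Hom a b),
    component b ∘ fmap F f = fmap G f ∘ component a
}.

Definition is_equivalence (C D : Category) (F : Functor C D) : Prop :=
  exists G : Functor D C,
    (exists α : NatTrans (id_functor C) (comp_functor G F),
       forall a, is_iso (α a)) /\
    (exists β : NatTrans (comp_functor F G) (id_functor D),
       forall b, is_iso (β b)).

(* [Adjunction F U] : F is left adjoint to U. *)
Record Adjunction (C D : Category) (F : Functor C D) (U : Functor D C) : Type := {
  unit : NatTrans (id_functor C) (comp_functor U F);
  counit : NatTrans (comp_functor F U) (id_functor D);
  triangle_l : forall a : C, counit (F a) ∘ fmap F (unit a) = idm (F a);
  triangle_r : forall b : D, fmap U (counit b) ∘ unit (U b) = idm (U b)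
}.

Arguments unit {C D F U} _.
Arguments counit {C D F U} _.

Record Monad (C : Category) : Type := {
  mfun :> Functor C C;
  ret : NatTrans (id_functor C) mfun;
  mult : NatTrans (comp_functor mfun mfun) mfun;
  mult_ret_l : forall a, mult a ∘ ret (mfun a) = idm (mfun a);
  mult_ret_r : forall a, mult a ∘ fmap mfun (ret a) = idm (mfun a);
  mult_assoc : forall a, mult a ∘ mult (mfun a) = mult a ∘ fmap mfun (mult a)
}.

Arguments ret {C} _.
Arguments mult {C} _.

Record Algebra (C : Category) (T : Monad C) : Type := {
  carrier :> C;
  action : Hom (T carrier) carrier;
  action_ret : action ∘ ret T carrier = idm carrier;
  action_mult : action ∘ mult T carrier = action ∘ fmap T action
}.

Arguments action {C T} _.

Lemma sig_eq (A : Type) (P : A -> Prop) (x y : {a | P a}) :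
  proj1_sig x = proj1_sig y -> x = y.
Proof.
  destruct x as [x px], y as [y py]; simpl; intros e; subst y.
  now rewrite (proof_irrelevance _ px py).
Qed.

Definition AlgebraHom (C : Category) (T : Monad C) (X Y : Algebra T) : Type :=
  {h : Hom X Y | h ∘ action X = action Y ∘ fmap T h}.

Definition algebra_id (C : Category) (T : Monad C) (X : Algebra T) : AlgebraHom X X.
Proof.
  exists (idm X).
  abstract (now rewrite fmap_id, comp_idl, comp_idr).
Defined.

Definition algebra_comp (C : Category) (T : Monad C) (X Y Z : Algebra T)
  (g : AlgebraHom Y Z) (f : AlgebraHom X Y) : AlgebraHom X Z.
Proof.
  exists (proj1_sig g ∘ proj1_sig f).
  abstract (now rewrite <- comp_assoc, (proj2_sig f), comp_assoc, (proj2_sig g),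
            <- comp_assoc, fmap_comp).
Defined.

Definition EilenbergMoore (C : Category) (T : Monad C) : Category.
Proof.
  refine {| Ob := Algebra T;
            Hom := @AlgebraHom C T;
            idm := @algebra_id C T;
            comp := @algebra_comp C T |}.
  - abstract (intros; apply sig_eq; apply comp_assoc).
  - abstract (intros; apply sig_eq; apply comp_idl).
  - abstract (intros; apply sig_eq; apply comp_idr).
Defined.

Definition adj_mult (C D : Category) (F : Functor C D) (U : Functor D C)
  (adj : Adjunction F U) :
  NatTrans (comp_functor (comp_functor U F) (comp_functor U F)) (comp_functor U F).
Proof.
  refine {| component := fun a : C =>
    (fmap U (counit adj (F a)) : Hom (comp_functor (comp_functor U F) (comp_functor U F) a)
                                     (comp_functor U F a)) |}.
  abstract (intros a b f; simpl; rewrite <- !fmap_comp;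
            exact (f_equal (fmap U) (naturality (counit adj) (fmap F f)))).
Defined.

Definition adj_monad (C D : Category) (F : Functor C D) (U : Functor D C)
  (adj : Adjunction F U) : Monad C.
Proof.
  refine {| mfun := comp_functor U F; ret := unit adj; mult := adj_mult adj |}.
  - abstract (intros a; exact (triangle_r adj (F a))).
  - abstract (intros a; exact (eq_trans (eq_sym (fmap_comp U _ _))
      (eq_trans (f_equal (fmap U) (triangle_l adj a)) (fmap_id U _)))).
  - abstract (intros a; simpl; rewrite <- !fmap_comp;
              exact (f_equal (fmap U)
                       (eq_sym (naturality (counit adj) (counit adj (F a)))))).
Defined.

Definition comparison_ob (C D : Category) (F : Functor C D) (U : Functor D C)
  (adj : Adjunction F U) (d : D) : Algebra (adj_monad adj).
Proof.
  refine (@Build_Algebra C (adj_monad adj) (U d) (fmap U (counit adj d)) _ _).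
  - abstract (exact (triangle_r adj d)).
  - abstract (simpl; rewrite <- !fmap_comp;
              exact (f_equal (fmap U) (eq_sym (naturality (counit adj) (counit adj d))))).
Defined.

Definition comparison_hom (C D : Category) (F : Functor C D) (U : Functor D C)
  (adj : Adjunction F U) (d e : D) (f : Hom d e) :
  AlgebraHom (comparison_ob adj d) (comparison_ob adj e).
Proof.
  exists (fmap U f).
  abstract (simpl; rewrite <- !fmap_comp;
            exact (f_equal (fmap U) (eq_sym (naturality (counit adj) f)))).
Defined.

Definition comparison (C D : Category) (F : Functor C D) (U : Functor D C)
  (adj : Adjunction F U) : Functor D (EilenbergMoore (adj_monad adj)).
Proof.
  refine (@Build_Functor D (EilenbergMoore (adj_monad adj))
            (comparison_ob adj) (@comparison_hom _ _ _ _ adj) _ _).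
  - abstract (intros; apply sig_eq; apply fmap_id).
  - abstract (intros; apply sig_eq; apply fmap_comp).
Defined.

Definition is_monadic (C D : Category) (U : Functor D C) : Prop :=
  exists (F : Functor C D) (adj : Adjunction F U), is_equivalence (comparison adj).

Definition is_pullback (C : Category) (p a b c : C) (p1 : Hom p a) (p2 : Hom p b)
  (f : Hom a c) (g : Hom b c) : Prop :=
  f ∘ p1 = g ∘ p2 /\
  forall (q : C) (u : Hom q a) (v : Hom q b), f ∘ u = g ∘ v ->
    exists! w : Hom q p, p1 ∘ w = u /\ p2 ∘ w = v.

Record Pullbacks (C : Category) : Type := {
  pb : forall (a b c : C) (f : Hom a c) (g : Hom b c), C;
  pb_fst : forall (a b c : C) (f : Hom a c) (g : Hom b c), Hom (pb f g) a;
  pb_snd : forall (a b c : C) (f : Hom a c) (g : Hom b c), Hom (pb f g) b;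
  pb_pair : forall (a b c : C) (f : Hom a c) (g : Hom b c)
    (q : C) (u : Hom q a) (v : Hom q b), f ∘ u = g ∘ v -> Hom q (pb f g);
  pb_square : forall (a b c : C) (f : Hom a c) (g : Hom b c),
    f ∘ pb_fst f g = g ∘ pb_snd f g;
  pb_fst_pair : forall (a b c : C) (f : Hom a c) (g : Hom b c)
    (q : C) (u : Hom q a) (v : Hom q b) (e : f ∘ u = g ∘ v),
    pb_fst f g ∘ pb_pair e = u;
  pb_snd_pair : forall (a b c : C) (f : Hom a c) (g : Hom b c)
    (q : C) (u : Hom q a) (v : Hom q b) (e : f ∘ u = g ∘ v),
    pb_snd f g ∘ pb_pair e = v;
  pb_ext : forall (a b c : C) (f : Hom a c) (g : Hom b c)
    (q : C) (w w' : Hom q (pb f g)),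
    pb_fst f g ∘ w = pb_fst f g ∘ w' -> pb_snd f g ∘ w = pb_snd f g ∘ w' -> w = w'
}.

Arguments pb {C} _ {a b c} f g.
Arguments pb_fst {C} _ {a b c} f g.
Arguments pb_snd {C} _ {a b c} f g.
Arguments pb_pair {C} _ {a b c f g q u v} e.
Arguments pb_square {C} _ {a b c} f g.

Lemma pb_is_pullback (C : Category) (P : Pullbacks C) (a b c : C)
  (f : Hom a c) (g : Hom b c) : is_pullback (pb_fst P f g) (pb_snd P f g) f g.
Proof.
  split; [apply pb_square |].
  intros q u v e; exists (pb_pair P e); split.
  - split; [apply pb_fst_pair | apply pb_snd_pair].
  - intros w [e1 e2]; apply pb_ext.
    + now rewrite pb_fst_pair.
    + now rewrite pb_snd_pair.
Qed.

Definition SliceHom (C : Category) (b : C) (x y : {a : C & Hom a b}) : Type :=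
  {h : Hom (projT1 x) (projT1 y) | projT2 y ∘ h = projT2 x}.

Definition slice_id (C : Category) (b : C) (x : {a : C & Hom a b}) : SliceHom x x :=
  exist _ (idm (projT1 x)) (comp_idr (projT2 x)).

Definition slice_comp (C : Category) (b : C) (x y z : {a : C & Hom a b})
  (g : SliceHom y z) (f : SliceHom x y) : SliceHom x z.
Proof.
  exists (proj1_sig g ∘ proj1_sig f).
  abstract (now rewrite comp_assoc, (proj2_sig g), (proj2_sig f)).
Defined.

Definition Slice (C : Category) (b : C) : Category.
Proof.
  refine {| Ob := {a : C & Hom a b};
            Hom := @SliceHom C b;
            idm := @slice_id C b;
            comp := @slice_comp C b |}.
  - abstract (intros; apply sig_eq; apply comp_assoc).
  - abstract (intros; apply sig_eq; apply comp_idl).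
  - abstract (intros; apply sig_eq; apply comp_idr).
Defined.

Definition pullback_ob (C : Category) (P : Pullbacks C) (c b : C) (p : Hom c b)
  (x : Slice b) : Slice c :=
  existT _ (pb P p (projT2 x)) (pb_fst P p (projT2 x)).

Lemma pullback_hom_square (C : Category) (P : Pullbacks C) (c b : C) (p : Hom c b)
  (x y : Slice b) (h : Hom x y) :
  p ∘ pb_fst P p (projT2 x) = projT2 y ∘ (proj1_sig h ∘ pb_snd P p (projT2 x)).
Proof. now rewrite comp_assoc, (proj2_sig h), pb_square. Qed.

Definition pullback_hom (C : Category) (P : Pullbacks C) (c b : C) (p : Hom c b)
  (x y : Slice b) (h : Hom x y) : Hom (pullback_ob P p x) (pullback_ob P p y) :=
  exist _ (pb_pair P (pullback_hom_square P p h)) (pb_fst_pair P _).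

Definition pullback_functor (C : Category) (P : Pullbacks C) (c b : C) (p : Hom c b) :
  Functor (Slice b) (Slice c).
Proof.
  refine {| fob := pullback_ob P p; fmap := @pullback_hom C P c b p |}.
  - abstract (intros x; apply sig_eq; simpl; apply pb_ext;
      [rewrite pb_fst_pair | rewrite pb_snd_pair; simpl; rewrite comp_idl];
      now rewrite comp_idr).
  - abstract (intros x y z g f; apply sig_eq; simpl; apply pb_ext;
      rewrite comp_assoc;
      [now rewrite !pb_fst_pair |
       rewrite !pb_snd_pair; simpl;
       now rewrite <- !comp_assoc, pb_snd_pair]).
Defined.

Definition is_effective_descent (C : Category) (P : Pullbacks C) (c b : C)
  (p : Hom c b) : Prop :=
  is_monadic (pullback_functor P p).

Definition MorClass (C : Category) : Type := forall a b : C, Hom a b -> Prop.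

Record is_factorization_system (C : Category) (E M : MorClass C) : Prop := {
  fs_E_iso : forall (a b : C) (f : Hom a b), is_iso f -> E a b f;
  fs_M_iso : forall (a b : C) (f : Hom a b), is_iso f -> M a b f;
  fs_E_comp : forall (a b c : C) (g : Hom b c) (f : Hom a b),
    E a b f -> E b c g -> E a c (g ∘ f);
  fs_M_comp : forall (a b c : C) (g : Hom b c) (f : Hom a b),
    M a b f -> M b c g -> M a c (g ∘ f);
  fs_factor : forall (a b : C) (f : Hom a b),
    exists (i : C) (e : Hom a i) (m : Hom i b), E a i e /\ M i b m /\ f = m ∘ e;
  fs_lift : forall (a b c d : C) (e : Hom a b) (m : Hom c d)
    (u : Hom a c) (v : Hom b d), E a b e -> M c d m -> m ∘ u = v ∘ e ->
    exists! w : Hom b c, w ∘ e = u /\ m ∘ w = v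
}.

Definition inverted (C X : Category) (I : Functor C X) : MorClass C :=
  fun a b f => is_iso (fmap I f).

Definition trivial_covering (C X : Category) (I : Functor C X) (H : Functor X C)
  (adj : Adjunction I H) : MorClass C :=
  fun a b f => is_pullback (unit adj a) f (fmap H (fmap I f)) (unit adj b).

Definition stabilized (C : Category) (P : Pullbacks C) (E : MorClass C) : MorClass C :=
  fun a b f => forall (c : C) (g : Hom c b), E (pb P g f) c (pb_fst P g f).

Definition localized (C : Category) (P : Pullbacks C) (M : MorClass C) : MorClass C :=
  fun a b f => exists (c : C) (p : Hom c b),
    is_effective_descent P p /\ M (pb P p f) c (pb_fst P p f).

Definition has_monotone_light_factorization (C X : Category) (P : Pullbacks C)
  (I : Functor C X) (H : Functor X C) (adj : Adjunction I H) : Prop :=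
  is_factorization_system (stabilized P (inverted I))
                          (localized P (trivial_covering adj)).

(* Objects, 1-cells and 2-cells form a 2-globular set (rather than hom-families,
   because equality of objects and of 1-cells matters), and the compositions are
   defined on composable pairs, composability being an equation of boundaries.
   Laws whose sides need composability proofs that follow from one another
   quantify over all of these proofs; by proof irrelevance this is the usual law.
   [comp1 g f], [vcomp b a] and [hcomp b a] are in applicative order. *)
Record TwoCategory : Type := {
  obj : Type;
  arr : Type;
  cell : Type;
  dom : arr -> obj;
  cod : arr -> obj;
  vdom : cell -> arr;
  vcod : cell -> arr;
  dom_vcod : forall a, dom (vcod a) = dom (vdom a);
  cod_vcod : forall a, cod (vcod a) = cod (vdom a);

  id1 : obj -> arr;
  comp1 : forall g f : arr, cod f = dom g -> arr;
  id2 : arr -> cell;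
  vcomp : forall b a : cell, vcod a = vdom b -> cell;
  hcomp : forall b a : cell, cod (vdom a) = dom (vdom b) -> cell;

  dom_id1 : forall x, dom (id1 x) = x;
  cod_id1 : forall x, cod (id1 x) = x;
  dom_comp1 : forall g f e, dom (@comp1 g f e) = dom f;
  cod_comp1 : forall g f e, cod (@comp1 g f e) = cod g;
  comp1_idl : forall f e, @comp1 (id1 (cod f)) f e = f;
  comp1_idr : forall f e, @comp1 f (id1 (dom f)) e = f;
  comp1_assoc : forall h g f e1 e2 e3 e4,
    @comp1 h (@comp1 g f e1) e2 = @comp1 (@comp1 h g e3) f e4;

  vdom_id2 : forall f, vdom (id2 f) = f;
  vcod_id2 : forall f, vcod (id2 f) = f;
  vdom_vcomp : forall b a e, vdom (@vcomp b a e) = vdom a;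
  vcod_vcomp : forall b a e, vcod (@vcomp b a e) = vcod b;
  vcomp_idl : forall a e, @vcomp (id2 (vcod a)) a e = a;
  vcomp_idr : forall a e, @vcomp a (id2 (vdom a)) e = a;
  vcomp_assoc : forall c b a e1 e2 e3 e4,
    @vcomp c (@vcomp b a e1) e2 = @vcomp (@vcomp c b e3) a e4;

  vdom_hcomp : forall b a e, vdom (@hcomp b a e) = @comp1 (vdom b) (vdom a) e;
  vcod_hcomp : forall b a e e', vcod (@hcomp b a e) = @comp1 (vcod b) (vcod a) e';
  hcomp_idl : forall a e, @hcomp (id2 (id1 (cod (vdom a)))) a e = a;
  hcomp_idr : forall a e, @hcomp a (id2 (id1 (dom (vdom a)))) e = a;
  hcomp_assoc : forall c b a e1 e2 e3 e4,
    @hcomp c (@hcomp b a e1) e2 = @hcomp (@hcomp c b e3) a e4;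

  hcomp_id2 : forall g f e e', @hcomp (id2 g) (id2 f) e = id2 (@comp1 g f e');
  interchange : forall d c b a e1 e2 e3 e4 e5 e6,
    @hcomp (@vcomp d c e1) (@vcomp b a e2) e3 =
    @vcomp (@hcomp d b e4) (@hcomp c a e5) e6
}.

Arguments dom {_} _.
Arguments cod {_} _.
Arguments vdom {_} _.
Arguments vcod {_} _.
Arguments id1 {_} _.
Arguments id2 {_} _.
Arguments comp1 {_} g f e.
Arguments vcomp {_} b a e.
Arguments hcomp {_} b a e.

Record TwoFunctor (A B : TwoCategory) : Type := {
  F0 : obj A -> obj B;
  F1 : arr A -> arr B;
  F2 : cell A -> cell B;
  F_dom : forall f, dom (F1 f) = F0 (dom f);
  F_cod : forall f, cod (F1 f) = F0 (cod f);
  F_vdom : forall a, vdom (F2 a) = F1 (vdom a);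
  F_vcod : forall a, vcod (F2 a) = F1 (vcod a);
  F_id1 : forall x, F1 (id1 x) = id1 (F0 x);
  F_id2 : forall f, F2 (id2 f) = id2 (F1 f);
  F_comp1 : forall g f e e', F1 (comp1 g f e) = comp1 (F1 g) (F1 f) e';
  F_vcomp : forall b a e e', F2 (vcomp b a e) = vcomp (F2 b) (F2 a) e';
  F_hcomp : forall b a e e', F2 (hcomp b a e) = hcomp (F2 b) (F2 a) e'
}.

Arguments F0 {A B} _ _.
Arguments F1 {A B} _ _.
Arguments F2 {A B} _ _.
Arguments F_dom {A B} _ _.
Arguments F_cod {A B} _ _.
Arguments F_vdom {A B} _ _.
Arguments F_vcod {A B} _ _.
Arguments F_id1 {A B} _ _.
Arguments F_id2 {A B} _ _.
Arguments F_comp1 {A B} _ {g f} e e'.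
Arguments F_vcomp {A B} _ {b a} e e'.
Arguments F_hcomp {A B} _ {b a} e e'.

Lemma two_functor_eq (A B : TwoCategory) (F G : TwoFunctor A B) :
  (forall x, F0 F x = F0 G x) -> (forall f, F1 F f = F1 G f) ->
  (forall a, F2 F a = F2 G a) -> F = G.
Proof.
  destruct F, G; simpl; intros e0 e1 e2.
  apply functional_extensionality in e0, e1, e2; subst.
  f_equal; apply proof_irrelevance.
Qed.

Lemma comp1_eq (A : TwoCategory) (g g' f f' : arr A) e e' :
  g = g' -> f = f' -> comp1 g f e = comp1 g' f' e'.
Proof. intros -> ->; f_equal; apply proof_irrelevance. Qed.

Lemma comp1_idl_eq (A : TwoCategory) (g f : arr A) e :
  g = id1 (cod f) -> comp1 g f e = f.
Proof. intros ->; apply comp1_idl. Qed.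

Lemma comp1_idr_eq (A : TwoCategory) (g f : arr A) e :
  f = id1 (dom g) -> comp1 g f e = g.
Proof. intros ->; apply comp1_idr. Qed.

Lemma vcomp_eq (A : TwoCategory) (b b' a a' : cell A) e e' :
  b = b' -> a = a' -> vcomp b a e = vcomp b' a' e'.
Proof. intros -> ->; f_equal; apply proof_irrelevance. Qed.

Lemma hcomp_eq (A : TwoCategory) (b b' a a' : cell A) e e' :
  b = b' -> a = a' -> hcomp b a e = hcomp b' a' e'.
Proof. intros -> ->; f_equal; apply proof_irrelevance. Qed.

Lemma F1_composable (A B : TwoCategory) (F : TwoFunctor A B) (g f : arr A) :
  cod f = dom g -> cod (F1 F f) = dom (F1 F g).
Proof. intros e; rewrite F_cod, F_dom; congruence. Qed.

Lemma F2_vcomposable (A B : TwoCategory) (F : TwoFunctor A B) (b a : cell A) :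
  vcod a = vdom b -> vcod (F2 F a) = vdom (F2 F b).
Proof. intros e; rewrite F_vcod, F_vdom; congruence. Qed.

Lemma F2_hcomposable (A B : TwoCategory) (F : TwoFunctor A B) (b a : cell A) :
  cod (vdom a) = dom (vdom b) -> cod (vdom (F2 F a)) = dom (vdom (F2 F b)).
Proof. intros e; rewrite !F_vdom; now apply F1_composable. Qed.

Definition two_functor_id (A : TwoCategory) : TwoFunctor A A.
Proof.
  refine {| F0 := fun x => x; F1 := fun f => f; F2 := fun a => a |};
    abstract (intros; first [reflexivity | apply comp1_eq; reflexivity
              | apply vcomp_eq; reflexivity | apply hcomp_eq; reflexivity]).
Defined.

Definition two_functor_comp (A B C : TwoCategory)
  (G : TwoFunctor B C) (F : TwoFunctor A B) : TwoFunctor A C.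
Proof.
  refine {| F0 := fun x => F0 G (F0 F x);
            F1 := fun f => F1 G (F1 F f);
            F2 := fun a => F2 G (F2 F a) |}.
  - abstract (intros; now rewrite !F_dom).
  - abstract (intros; now rewrite !F_cod).
  - abstract (intros; now rewrite !F_vdom).
  - abstract (intros; now rewrite !F_vcod).
  - abstract (intros; now rewrite !F_id1).
  - abstract (intros; now rewrite !F_id2).
  - abstract (intros g f e e'; rewrite (F_comp1 F e (F1_composable F e));
              apply F_comp1).
  - abstract (intros b a e e'; rewrite (F_vcomp F e (F2_vcomposable F e));
              apply F_vcomp).
  - abstract (intros b a e e'; rewrite (F_hcomp F e (F2_hcomposable F e));
              apply F_hcomp).
Defined.

Definition TwoCat : Category.
Proof.
  refine {| Ob := TwoCategory;
            Hom := TwoFunctor;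
            idm := two_functor_id;
            comp := two_functor_comp |};
    abstract (intros; apply two_functor_eq; reflexivity).
Defined.

Definition fiber_product (X Y Z : Type) (f : X -> Z) (g : Y -> Z) : Type :=
  {xy : X * Y | f (fst xy) = g (snd xy)}.

Definition fp1 (X Y Z : Type) (f : X -> Z) (g : Y -> Z) (p : fiber_product f g) : X :=
  fst (proj1_sig p).

Definition fp2 (X Y Z : Type) (f : X -> Z) (g : Y -> Z) (p : fiber_product f g) : Y :=
  snd (proj1_sig p).

Definition fp (X Y Z : Type) (f : X -> Z) (g : Y -> Z) (x : X) (y : Y)
  (e : f x = g y) : fiber_product f g :=
  exist _ (x, y) e.

Lemma fp_square (X Y Z : Type) (f : X -> Z) (g : Y -> Z) (p : fiber_product f g) :
  f (fp1 p) = g (fp2 p).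
Proof. exact (proj2_sig p). Qed.

Lemma fp_ext (X Y Z : Type) (f : X -> Z) (g : Y -> Z) (p q : fiber_product f g) :
  fp1 p = fp1 q -> fp2 p = fp2 q -> p = q.
Proof.
  destruct p as [[x y] e], q as [[x' y'] e']; unfold fp1, fp2; simpl.
  intros; apply sig_eq; simpl; congruence.
Qed.

Section TwoPullback.
Context (A B C : TwoCategory) (F : TwoFunctor A C) (G : TwoFunctor B C).

Notation O := (fiber_product (F0 F) (F0 G)).
Notation R := (fiber_product (F1 F) (F1 G)).
Notation L := (fiber_product (F2 F) (F2 G)).

Lemma tp_dom_square (f : R) : F0 F (dom (fp1 f)) = F0 G (dom (fp2 f)).
Proof. now rewrite <- !F_dom, fp_square. Qed.

Lemma tp_cod_square (f : R) : F0 F (cod (fp1 f)) = F0 G (cod (fp2 f)).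
Proof. now rewrite <- !F_cod, fp_square. Qed.

Lemma tp_vdom_square (a : L) : F1 F (vdom (fp1 a)) = F1 G (vdom (fp2 a)).
Proof. now rewrite <- !F_vdom, fp_square. Qed.

Lemma tp_vcod_square (a : L) : F1 F (vcod (fp1 a)) = F1 G (vcod (fp2 a)).
Proof. now rewrite <- !F_vcod, fp_square. Qed.

Lemma tp_id1_square (x : O) : F1 F (id1 (fp1 x)) = F1 G (id1 (fp2 x)).
Proof. now rewrite !F_id1, fp_square. Qed.

Lemma tp_id2_square (f : R) : F2 F (id2 (fp1 f)) = F2 G (id2 (fp2 f)).
Proof. now rewrite !F_id2, fp_square. Qed.

Definition tp_dom (f : R) : O := fp (tp_dom_square f).
Definition tp_cod (f : R) : O := fp (tp_cod_square f).
Definition tp_vdom (a : L) : R := fp (tp_vdom_square a).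
Definition tp_vcod (a : L) : R := fp (tp_vcod_square a).
Definition tp_id1 (x : O) : R := fp (tp_id1_square x).
Definition tp_id2 (f : R) : L := fp (tp_id2_square f).

Lemma tp_comp1_square (g f : R) (e : tp_cod f = tp_dom g) :
  F1 F (comp1 (fp1 g) (fp1 f) (f_equal (@fp1 _ _ _ _ _) e)) =
  F1 G (comp1 (fp2 g) (fp2 f) (f_equal (@fp2 _ _ _ _ _) e)).
Proof.
  rewrite (F_comp1 F _ (F1_composable F (f_equal (@fp1 _ _ _ _ _) e))).
  rewrite (F_comp1 G _ (F1_composable G (f_equal (@fp2 _ _ _ _ _) e))).
  apply comp1_eq; apply fp_square.
Qed.

Lemma tp_vcomp_square (b a : L) (e : tp_vcod a = tp_vdom b) :
  F2 F (vcomp (fp1 b) (fp1 a) (f_equal (@fp1 _ _ _ _ _) e)) =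
  F2 G (vcomp (fp2 b) (fp2 a) (f_equal (@fp2 _ _ _ _ _) e)).
Proof.
  rewrite (F_vcomp F _ (F2_vcomposable F (f_equal (@fp1 _ _ _ _ _) e))).
  rewrite (F_vcomp G _ (F2_vcomposable G (f_equal (@fp2 _ _ _ _ _) e))).
  apply vcomp_eq; apply fp_square.
Qed.

Lemma tp_hcomp_square (b a : L) (e : tp_cod (tp_vdom a) = tp_dom (tp_vdom b)) :
  F2 F (hcomp (fp1 b) (fp1 a) (f_equal (@fp1 _ _ _ _ _) e)) =
  F2 G (hcomp (fp2 b) (fp2 a) (f_equal (@fp2 _ _ _ _ _) e)).
Proof.
  rewrite (F_hcomp F _ (F2_hcomposable F (f_equal (@fp1 _ _ _ _ _) e))).
  rewrite (F_hcomp G _ (F2_hcomposable G (f_equal (@fp2 _ _ _ _ _) e))).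
  apply hcomp_eq; apply fp_square.
Qed.

Definition two_pullback : TwoCategory.
Proof.
  refine {| obj := O; arr := R; cell := L;
            dom := tp_dom; cod := tp_cod; vdom := tp_vdom; vcod := tp_vcod;
            id1 := tp_id1; id2 := tp_id2;
            comp1 := fun g f e => fp (tp_comp1_square e);
            vcomp := fun b a e => fp (tp_vcomp_square e);
            hcomp := fun b a e => fp (tp_hcomp_square e) |}.
  - abstract (intros; apply fp_ext; apply dom_vcod).
  - abstract (intros; apply fp_ext; apply cod_vcod).
  - abstract (intros; apply fp_ext; apply dom_id1).
  - abstract (intros; apply fp_ext; apply cod_id1).
  - abstract (intros; apply fp_ext; apply dom_comp1).
  - abstract (intros; apply fp_ext; apply cod_comp1).
  - abstract (intros; apply fp_ext; apply comp1_idl).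
  - abstract (intros; apply fp_ext; apply comp1_idr).
  - abstract (intros; apply fp_ext; apply comp1_assoc).
  - abstract (intros; apply fp_ext; apply vdom_id2).
  - abstract (intros; apply fp_ext; apply vcod_id2).
  - abstract (intros; apply fp_ext; apply vdom_vcomp).
  - abstract (intros; apply fp_ext; apply vcod_vcomp).
  - abstract (intros; apply fp_ext; apply vcomp_idl).
  - abstract (intros; apply fp_ext; apply vcomp_idr).
  - abstract (intros; apply fp_ext; apply vcomp_assoc).
  - abstract (intros; apply fp_ext; apply vdom_hcomp).
  - abstract (intros; apply fp_ext; apply vcod_hcomp).
  - abstract (intros; apply fp_ext; apply hcomp_idl).
  - abstract (intros; apply fp_ext; apply hcomp_idr).
  - abstract (intros; apply fp_ext; apply hcomp_assoc).
  - abstract (intros; apply fp_ext; apply hcomp_id2).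
  - abstract (intros; apply fp_ext; apply interchange).
Defined.

Definition two_pullback_fst : TwoFunctor two_pullback A.
Proof.
  refine (@Build_TwoFunctor two_pullback A (@fp1 _ _ _ _ _) (@fp1 _ _ _ _ _)
            (@fp1 _ _ _ _ _) _ _ _ _ _ _ _ _ _);
    abstract (intros; first [reflexivity | apply comp1_eq; reflexivity
              | apply vcomp_eq; reflexivity | apply hcomp_eq; reflexivity]).
Defined.

Definition two_pullback_snd : TwoFunctor two_pullback B.
Proof.
  refine (@Build_TwoFunctor two_pullback B (@fp2 _ _ _ _ _) (@fp2 _ _ _ _ _)
            (@fp2 _ _ _ _ _) _ _ _ _ _ _ _ _ _);
    abstract (intros; first [reflexivity | apply comp1_eq; reflexivity
              | apply vcomp_eq; reflexivity | apply hcomp_eq; reflexivity]).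
Defined.

Definition two_pullback_pair (Q : TwoCategory) (U : TwoFunctor Q A) (V : TwoFunctor Q B)
  (e : two_functor_comp F U = two_functor_comp G V) : TwoFunctor Q two_pullback.
Proof.
  refine (@Build_TwoFunctor Q two_pullback
            (fun x => fp (f_equal (fun K => F0 K x) e : F0 F (F0 U x) = F0 G (F0 V x)))
            (fun f => fp (f_equal (fun K => F1 K f) e : F1 F (F1 U f) = F1 G (F1 V f)))
            (fun a => fp (f_equal (fun K => F2 K a) e : F2 F (F2 U a) = F2 G (F2 V a)))
            _ _ _ _ _ _ _ _ _).
  - abstract (intros; apply fp_ext; apply F_dom).
  - abstract (intros; apply fp_ext; apply F_cod).
  - abstract (intros; apply fp_ext; apply F_vdom).
  - abstract (intros; apply fp_ext; apply F_vcod).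
  - abstract (intros; apply fp_ext; apply F_id1).
  - abstract (intros; apply fp_ext; apply F_id2).
  - abstract (intros; apply fp_ext; apply F_comp1).
  - abstract (intros; apply fp_ext; apply F_vcomp).
  - abstract (intros; apply fp_ext; apply F_hcomp).
Defined.

End TwoPullback.

Definition TwoCat_pullbacks : Pullbacks TwoCat.
Proof.
  refine (@Build_Pullbacks TwoCat two_pullback two_pullback_fst two_pullback_snd
            two_pullback_pair _ _ _ _).
  - abstract (intros; apply two_functor_eq; intros; apply fp_square).
  - abstract (intros; apply two_functor_eq; reflexivity).
  - abstract (intros; apply two_functor_eq; reflexivity).
  - abstract (intros a b c f g q w w' e1 e2; apply two_functor_eq; intros x;
      apply fp_ext;
      [ exact (f_equal (fun K => F0 K x) e1) | exact (f_equal (fun K => F0 K x) e2)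
      | exact (f_equal (fun K => F1 K x) e1) | exact (f_equal (fun K => F1 K x) e2)
      | exact (f_equal (fun K => F2 K x) e1) | exact (f_equal (fun K => F2 K x) e2) ]).
Defined.

Definition is_two_preorder (A : TwoCategory) : Prop :=
  forall a b : cell A, vdom a = vdom b -> vcod a = vcod b -> a = b.

Definition full_subcategory (C : Category) (P : C -> Prop) : Category :=
  {| Ob := {a : C | P a};
     Hom := fun a b => Hom (proj1_sig a) (proj1_sig b);
     idm := fun a => idm (proj1_sig a);
     comp := fun a b c g f => g ∘ f;
     comp_assoc := fun _ _ _ _ h g f => comp_assoc h g f;
     comp_idl := fun _ _ f => comp_idl f;
     comp_idr := fun _ _ f => comp_idr f |}.

Definition full_inclusion (C : Category) (P : C -> Prop) :
  Functor (full_subcategory P) C :=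
  {| fob := fun a : full_subcategory P => proj1_sig a;
     fmap := fun _ _ f => f;
     fmap_id := fun _ => eq_refl;
     fmap_comp := fun _ _ _ _ _ => eq_refl |}.

Definition TwoPreord : Category := full_subcategory (C := TwoCat) is_two_preorder.

Definition inclusion_H : Functor TwoPreord TwoCat :=
  full_inclusion (C := TwoCat) is_two_preorder.

Section Reflect.
Context (A : TwoCategory).

(* The quotient of the 2-cells of A by "same vertical domain and same vertical
   codomain", realized as the image of (vdom, vcod). *)
Definition rcell : Type :=
  {fg : arr A * arr A | exists a : cell A, vdom a = fst fg /\ vcod a = snd fg}.

Definition rclass (a : cell A) : rcell :=
  exist _ (vdom a, vcod a) (ex_intro _ a (conj eq_refl eq_refl)).

Definition rdom (r : rcell) : arr A := fst (proj1_sig r).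
Definition rcod (r : rcell) : arr A := snd (proj1_sig r).

Lemma rcell_ext (r s : rcell) : rdom r = rdom s -> rcod r = rcod s -> r = s.
Proof.
  destruct r as [[f g] p], s as [[f' g'] p']; unfold rdom, rcod; simpl.
  intros; apply sig_eq; simpl; congruence.
Qed.

Lemma rclass_surj (r : rcell) : exists a, rclass a = r.
Proof.
  destruct r as [[f g] [a [e1 e2]]]; exists a; apply sig_eq; simpl in *; congruence.
Qed.

Lemma rdom_boundary (r : rcell) : dom (rcod r) = dom (rdom r).
Proof. destruct (rclass_surj r) as [a <-]; apply dom_vcod. Qed.

Lemma rcod_boundary (r : rcell) : cod (rcod r) = cod (rdom r).
Proof. destruct (rclass_surj r) as [a <-]; apply cod_vcod. Qed.

Lemma rvcomp_inhabited (s r : rcell) : rcod r = rdom s ->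
  exists a : cell A, vdom a = rdom r /\ vcod a = rcod s.
Proof.
  destruct (rclass_surj r) as [a <-], (rclass_surj s) as [b <-].
  intros e; exists (vcomp b a e); split; [apply vdom_vcomp | apply vcod_vcomp].
Qed.

Lemma rcod_composable (s r : rcell) :
  cod (rdom r) = dom (rdom s) -> cod (rcod r) = dom (rcod s).
Proof. now rewrite rcod_boundary, rdom_boundary. Qed.

Lemma rhcomp_inhabited (s r : rcell) (e : cod (rdom r) = dom (rdom s)) :
  exists a : cell A,
    vdom a = comp1 (rdom s) (rdom r) e /\
    vcod a = comp1 (rcod s) (rcod r) (rcod_composable e).
Proof.
  destruct (rclass_surj r) as [a <-], (rclass_surj s) as [b <-].
  exists (hcomp b a e); split; [apply vdom_hcomp | apply vcod_hcomp].
Qed.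

Definition reflect : TwoCategory.
Proof.
  refine {| obj := obj A; arr := arr A; cell := rcell;
            dom := dom; cod := cod; vdom := rdom; vcod := rcod;
            id1 := id1; comp1 := comp1;
            id2 := fun f => rclass (id2 f);
            vcomp := fun s r e =>
              exist _ (rdom r, rcod s) (rvcomp_inhabited e);
            hcomp := fun s r e =>
              exist _ (comp1 (rdom s) (rdom r) e,
                       comp1 (rcod s) (rcod r) (rcod_composable e))
                    (rhcomp_inhabited e) |}.
  - exact rdom_boundary.
  - exact rcod_boundary.
  - exact (@dom_id1 A).
  - exact (@cod_id1 A).
  - exact (@dom_comp1 A).
  - exact (@cod_comp1 A).
  - exact (@comp1_idl A).
  - exact (@comp1_idr A).
  - exact (@comp1_assoc A).
  - exact (@vdom_id2 A).
  - exact (@vcod_id2 A).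
  - reflexivity.
  - reflexivity.
  - abstract (intros; apply rcell_ext; [reflexivity | apply vcod_id2]).
  - abstract (intros; apply rcell_ext; [apply vdom_id2 | reflexivity]).
  - abstract (intros; apply rcell_ext; reflexivity).
  - reflexivity.
  - abstract (intros; apply comp1_eq; reflexivity).
  - abstract (intros r e; apply rcell_ext; apply comp1_idl_eq;
      [ apply vdom_id2
      | exact (eq_trans (vcod_id2 _) (f_equal id1 (eq_sym (rcod_boundary r)))) ]).
  - abstract (intros r e; apply rcell_ext; apply comp1_idr_eq;
      [ apply vdom_id2
      | exact (eq_trans (vcod_id2 _) (f_equal id1 (eq_sym (rdom_boundary r)))) ]).
  - abstract (intros; apply rcell_ext; apply comp1_assoc).
  - abstract (intros; apply rcell_ext;
      [ refine (eq_trans _ (eq_sym (vdom_id2 _))); apply comp1_eq; apply vdom_id2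
      | refine (eq_trans _ (eq_sym (vcod_id2 _))); apply comp1_eq; apply vcod_id2 ]).
  - abstract (intros; apply rcell_ext; apply comp1_eq; reflexivity).
Defined.

Lemma reflect_two_preorder : is_two_preorder reflect.
Proof. intros r s; apply rcell_ext. Qed.

Definition reflect_unit : TwoFunctor A reflect.
Proof.
  refine (@Build_TwoFunctor A reflect (fun x => x) (fun f => f) rclass
            _ _ _ _ _ _ _ _ _).
  - reflexivity.
  - reflexivity.
  - reflexivity.
  - reflexivity.
  - reflexivity.
  - reflexivity.
  - abstract (intros; apply (@comp1_eq A); reflexivity).
  - abstract (intros; apply rcell_ext; [apply vdom_vcomp | apply vcod_vcomp]).
  - abstract (intros; apply rcell_ext;
      [exact (eq_trans (vdom_hcomp e) (comp1_eq (A := A) e e' eq_refl eq_refl))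
      | exact (vcod_hcomp e (rcod_composable e'))]).
Defined.

End Reflect.

Lemma reflect_map_cell (A B : TwoCategory) (F : TwoFunctor A B) (r : rcell A) :
  exists b : cell B, vdom b = F1 F (rdom r) /\ vcod b = F1 F (rcod r).
Proof.
  destruct (rclass_surj r) as [a <-]; exists (F2 F a); split;
    [apply F_vdom | apply F_vcod].
Qed.

Definition reflect_map (A B : TwoCategory) (F : TwoFunctor A B) :
  TwoFunctor (reflect A) (reflect B).
Proof.
  refine (@Build_TwoFunctor (reflect A) (reflect B) (F0 F) (F1 F)
            (fun r => exist _ (F1 F (rdom r), F1 F (rcod r)) (reflect_map_cell F r))
            _ _ _ _ _ _ _ _ _).
  - exact (F_dom F).
  - exact (F_cod F).
  - reflexivity.
  - reflexivity.
  - exact (F_id1 F).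
  - abstract (intros; apply rcell_ext;
      [ exact (eq_trans (f_equal (F1 F) (vdom_id2 _)) (eq_sym (vdom_id2 _)))
      | exact (eq_trans (f_equal (F1 F) (vcod_id2 _)) (eq_sym (vcod_id2 _))) ]).
  - exact (@F_comp1 _ _ F).
  - abstract (intros; apply rcell_ext; reflexivity).
  - abstract (intros; apply rcell_ext; apply F_comp1).
Defined.

Definition reflection_I : Functor TwoCat TwoPreord.
Proof.
  refine (@Build_Functor TwoCat TwoPreord
            (fun A => exist _ (reflect A) (@reflect_two_preorder A))
            reflect_map _ _);
    abstract (intros; apply two_functor_eq; intros; first [reflexivity |
      apply rcell_ext; reflexivity]).
Defined.

Section Counit.
Context (P : TwoCategory) (HP : is_two_preorder P).

Definition counit_cell (r : rcell P) : cell P :=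
  proj1_sig (constructive_indefinite_description _ (proj2_sig r)).

Lemma vdom_counit_cell r : vdom (counit_cell r) = rdom r.
Proof.
  exact (proj1 (proj2_sig (constructive_indefinite_description _ (proj2_sig r)))).
Qed.

Lemma vcod_counit_cell r : vcod (counit_cell r) = rcod r.
Proof.
  exact (proj2 (proj2_sig (constructive_indefinite_description _ (proj2_sig r)))).
Qed.

Definition reflect_counit : TwoFunctor (reflect P) P.
Proof.
  refine (@Build_TwoFunctor (reflect P) P (fun x => x) (fun f => f) counit_cell
            _ _ _ _ _ _ _ _ _).
  - reflexivity.
  - reflexivity.
  - exact vdom_counit_cell.
  - exact vcod_counit_cell.
  - reflexivity.
  - abstract (intros; apply HP;
      [ exact (vdom_counit_cell (rclass (@id2 P f)))
      | exact (vcod_counit_cell (rclass (@id2 P f))) ]).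
  - abstract (intros; apply (@comp1_eq P); reflexivity).
  - abstract (intros s r e e'; apply HP;
      [ rewrite vdom_counit_cell, vdom_vcomp, vdom_counit_cell; reflexivity
      | rewrite vcod_counit_cell, vcod_vcomp, vcod_counit_cell; reflexivity ]).
  - abstract (intros s r e e';
      assert (e'' : cod (vcod (counit_cell r)) = dom (vcod (counit_cell s)))
        by (rewrite cod_vcod, dom_vcod; exact e');
      apply HP;
      [ rewrite vdom_counit_cell, vdom_hcomp
      | rewrite vcod_counit_cell, (vcod_hcomp e' e'') ];
      apply comp1_eq; symmetry; first [apply vdom_counit_cell | apply vcod_counit_cell]).
Defined.

End Counit.

Definition reflection_unit : NatTrans (id_functor TwoCat) (comp_functor inclusion_H reflection_I).
Proof.
  refine (@Build_NatTrans TwoCat TwoCat (id_functor TwoCat)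
            (comp_functor inclusion_H reflection_I) reflect_unit _).
  abstract (intros A B F; apply two_functor_eq; intros; first [reflexivity |
    apply rcell_ext; [apply F_vdom | apply F_vcod]]).
Defined.

Definition reflection_counit :
  NatTrans (comp_functor reflection_I inclusion_H) (id_functor TwoPreord).
Proof.
  refine (@Build_NatTrans TwoPreord TwoPreord (comp_functor reflection_I inclusion_H)
            (id_functor TwoPreord)
            (fun P => reflect_counit (proj2_sig P)) _).
  abstract (intros [P HP] [Q HQ] F; apply two_functor_eq; simpl; intros r;
    first [reflexivity | apply HQ;
      [ rewrite F_vdom, !vdom_counit_cell; reflexivity
      | rewrite F_vcod, !vcod_counit_cell; reflexivity ]]).
Defined.

Definition reflection : Adjunction reflection_I inclusion_H.
Proof.
  refine {| unit := reflection_unit; counit := reflection_counit |}.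
  - abstract (intros A; apply two_functor_eq; simpl; intros r;
      first [reflexivity | apply rcell_ext;
        [exact (@vdom_counit_cell (reflect A) _) | exact (@vcod_counit_cell (reflect A) _)]]).
  - abstract (intros [P HP]; apply two_functor_eq; simpl; intros r;
      first [reflexivity | apply HP;
        [exact (@vdom_counit_cell P _) | exact (@vcod_counit_cell P _)]]).
Defined.

(* Main.v *)
(** Both classes have elementary descriptions: [E'] consists of the 2-functors that are
    bijective on objects and on 1-cells and surjective on 2-cells, [M*] of those that
    are injective on parallel 2-cells, and these evidently form a factorization system.

    The description of [E'] is tested by pulling back along 2-functors out of the
    walking 2-cell. For [M*], effective descent morphisms are surjective on 2-cells, so
    coverings are injective on parallel 2-cells; conversely such an [f : A -> B] becomes
    a 2-functor between 2-preorders, hence a trivial covering, after pulling back along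
    an effective descent morphism from a 2-preorder to [B].

    Such a morphism exists for every [B]: a 2-functor that is injective on objects and
    surjective on vertically composable triples of 2-cells is of effective descent,
    because descent data for it can be glued by a quotient, and the free horizontal
    strings of points on sequences of vertically composable 2-cells of [B], with the
    segments of the sequences as 2-cells, form a 2-preorder with such a functor to [B]. *)

From Stdlib Require Import FunctionalExtensionality PropExtensionality ClassicalEpsilon
  List Lia.
Require Import Defs.

Set Implicit Arguments.
Unset Strict Implicit.
Local Open Scope cat_scope.

Lemma exists_section (A B : Type) (f : A -> B) :
  (forall b, exists a, f a = b) -> exists s : B -> A, forall b, f (s b) = b.
Proof.
  intros H.
  exists (fun b => proj1_sig (constructive_indefinite_description _ (H b))).
  intros b; exact (proj2_sig (constructive_indefinite_description _ (H b))).
Qed.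

(** * Monadicity and descent in a category with pullbacks *)

Section Equivalences.
Context (C D : Category) (F : Functor C D).

Definition faithful : Prop :=
  forall (a b : C) (f g : Hom a b), fmap F f = fmap F g -> f = g.

Definition full : Prop :=
  forall (a b : C) (g : Hom (F a) (F b)), exists f : Hom a b, fmap F f = g.

Definition essentially_surjective : Prop :=
  forall d : D, exists (c : C) (u : Hom (F c) d), is_iso u.

Lemma equivalence_faithful : is_equivalence F -> faithful.
Proof.
  intros [G [[α Hα] _]] a b f g e.
  destruct (Hα b) as [β [Hβ _]].
  rewrite <- (comp_idl f), <- (comp_idl g); simpl in Hβ; rewrite <- Hβ.
  rewrite <- !comp_assoc; f_equal.
  pose proof (naturality α f) as n1; pose proof (naturality α g) as n2; simpl in *.
  now rewrite n1, n2, e.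
Qed.

(** The data live in [Type], so that a preimage of [d] up to isomorphism can be chosen once and used
    in building a functor. *)
Record Inverse (d : D) := {
  inv_ob : C;
  inv_to : Hom (F inv_ob) d;
  inv_from : Hom d (F inv_ob);
  inv_from_to : inv_from ∘ inv_to = idm (F inv_ob);
  inv_to_from : inv_to ∘ inv_from = idm d
}.

(** The pseudo-inverse sends [d] to its chosen preimage and a morphism to the lift of its conjugate
    by the chosen isomorphisms. Every equation to be checked holds after applying [F], and
    faithfulness reflects it. *)
Lemma equivalence_intro :
  faithful -> full -> essentially_surjective -> is_equivalence F.
Proof.
  intros Hfaith Hfull Heso.
  assert (S : forall d, Inverse d).
  { intros d.
    destruct (constructive_indefinite_description _ (Heso d)) as [c Hc].
    destruct (constructive_indefinite_description _ Hc) as [u Hu].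
    destruct (constructive_indefinite_description _ Hu) as [v [e1 e2]].
    exact (Build_Inverse e1 e2). }
  set (lift := fun (a b : C) (g : Hom (F a) (F b)) =>
    proj1_sig (constructive_indefinite_description _ (Hfull a b g))).
  assert (fmap_lift : forall a b (g : Hom (F a) (F b)), fmap F (lift a b g) = g)
    by (intros; exact (proj2_sig (constructive_indefinite_description _ (Hfull a b g)))).
  assert (Gid : forall d, lift _ _ (inv_from (S d) ∘ idm d ∘ inv_to (S d)) = idm _).
  { intros d; apply Hfaith; rewrite fmap_lift, fmap_id, comp_idr; apply inv_from_to. }
  assert (Gcomp : forall a b c (g : Hom b c) (f : Hom a b),
    lift _ _ (inv_from (S c) ∘ (g ∘ f) ∘ inv_to (S a)) =
    lift _ _ (inv_from (S c) ∘ g ∘ inv_to (S b)) ∘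
    lift _ _ (inv_from (S b) ∘ f ∘ inv_to (S a))).
  { intros a b c g f; apply Hfaith; rewrite fmap_comp, !fmap_lift.
    rewrite !comp_assoc; f_equal; f_equal.
    pose proof (inv_to_from (S b)) as e.
    now rewrite <- (comp_assoc _ _ (inv_from (S b))), e, comp_idr. }
  pose (G := Build_Functor (fob := fun d => inv_ob (S d)) Gid Gcomp).
  exists G; split.
  - assert (Hn : forall a b (f : Hom a b),
      lift b (G (F b)) (inv_from (S (F b))) ∘ f =
      fmap G (fmap F f) ∘ lift a (G (F a)) (inv_from (S (F a)))).
    { intros a b f; apply Hfaith; simpl; rewrite !fmap_comp, !fmap_lift.
      now rewrite <- !comp_assoc, inv_to_from, comp_idr. }
    exists (Build_NatTrans (F := id_functor C) (G := comp_functor G F) Hn).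
    intros a; exists (lift (G (F a)) a (inv_to (S (F a)))); simpl.
    split; apply Hfaith; rewrite fmap_comp, !fmap_lift, fmap_id.
    + apply inv_to_from.
    + apply inv_from_to.
  - assert (Hn : forall a b (f : Hom a b),
      inv_to (S b) ∘ fmap F (fmap G f) = f ∘ inv_to (S a)).
    { intros a b f; simpl; rewrite fmap_lift.
      now rewrite !comp_assoc, inv_to_from, comp_idl. }
    exists (Build_NatTrans (F := comp_functor F G) (G := id_functor D) Hn).
    intros b; exists (inv_from (S b)); split; [apply inv_from_to | apply inv_to_from].
Qed.

End Equivalences.

(** * The adjunction between composition with [p] and pullback along [p] *)

Section PullbackAdjunction.
Context (C : Category) (P : Pullbacks C) (c b : C) (p : Hom c b).

Lemma postcomp_square (x y : Slice c) (h : Hom x y) :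
  p ∘ projT2 y ∘ proj1_sig h = p ∘ projT2 x.
Proof. now rewrite <- comp_assoc, (proj2_sig h). Qed.

Definition postcomp : Functor (Slice c) (Slice b).
Proof.
  refine (@Build_Functor (Slice c) (Slice b)
    (fun x => existT _ (projT1 x) (p ∘ projT2 x))
    (fun x y h => exist _ (proj1_sig h) (postcomp_square h)) _ _);
    abstract (intros; now apply sig_eq).
Defined.

Lemma postcomp_unit_square (x : Slice c) : p ∘ projT2 x = p ∘ projT2 x ∘ idm _.
Proof. now rewrite comp_idr. Qed.

Definition postcomp_unit :
  NatTrans (id_functor (Slice c)) (comp_functor (pullback_functor P p) postcomp).
Proof.
  refine (@Build_NatTrans (Slice c) (Slice c) (id_functor _)
    (comp_functor (pullback_functor P p) postcomp)
    (fun x => exist _ (pb_pair P (postcomp_unit_square x)) (pb_fst_pair P _)) _).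
  abstract (intros x y h; apply sig_eq; simpl; apply pb_ext; rewrite 2!comp_assoc;
    [ now rewrite !pb_fst_pair, (proj2_sig h)
    | rewrite !pb_snd_pair, <- comp_assoc, pb_snd_pair; simpl;
      now rewrite comp_idl, comp_idr ]).
Defined.

Definition postcomp_counit :
  NatTrans (comp_functor postcomp (pullback_functor P p)) (id_functor (Slice b)).
Proof.
  refine (@Build_NatTrans (Slice b) (Slice b)
    (comp_functor postcomp (pullback_functor P p)) (id_functor _)
    (fun x => exist _ (pb_snd P p (projT2 x)) (eq_sym (pb_square P _ _))) _).
  abstract (intros x y h; apply sig_eq; simpl; now rewrite pb_snd_pair).
Defined.

Definition postcomp_adjunction : Adjunction postcomp (pullback_functor P p).
Proof.
  refine {| unit := postcomp_unit; counit := postcomp_counit |}.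
  - abstract (intros x; apply sig_eq; simpl; apply pb_snd_pair).
  - abstract (intros x; apply sig_eq; simpl; apply pb_ext; rewrite comp_assoc, comp_idr;
      [ now rewrite !pb_fst_pair
      | now rewrite pb_snd_pair, <- comp_assoc, pb_snd_pair, comp_idr ]).
Defined.

(** For any choice of left adjoint, the comparison functor acts on underlying morphisms as the
    pullback functor does, so its faithfulness is that of the pullback functor. *)
Lemma effective_descent_faithful :
  is_effective_descent P p -> faithful (pullback_functor P p).
Proof.
  intros [F [adj H]] x y f g e.
  apply (equivalence_faithful H), sig_eq; exact e.
Qed.

End PullbackAdjunction.

Lemma slice_iso (C : Category) (b : C) (x y : Slice b) (h : Hom x y) :
  is_iso (proj1_sig h) -> is_iso h.
Proof.
  intros [g [e1 e2]].
  assert (e : projT2 x ∘ g = projT2 y)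
    by (now rewrite <- (proj2_sig h), <- comp_assoc, e2, comp_idr).
  exists (exist _ g e); split; apply sig_eq; assumption.
Qed.

(** The inverse of an equivariant isomorphism is equivariant: the forgetful functor from algebras
    reflects isomorphisms. *)
Lemma algebra_iso (C : Category) (T : Monad C) (X Y : EilenbergMoore T) (h : Hom X Y) :
  is_iso (proj1_sig h) -> is_iso h.
Proof.
  intros [g [e1 e2]].
  assert (e : g ∘ action Y = action X ∘ fmap T g).
  { rewrite <- (comp_idr (action Y)), <- fmap_id, <- e2, fmap_comp.
    rewrite (comp_assoc (action Y)), <- (proj2_sig h), !comp_assoc, e1, comp_idl.
    reflexivity. }
  exists (exist _ g e); split; apply sig_eq; assumption.
Qed.

(** * A criterion for effective descent stated in the base category *)

Section DescentCriterion.
Context (C : Category) (P : Pullbacks C) (c b : C) (p : Hom c b).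

Notation K := (comparison (postcomp_adjunction P p)).

(** Pairing along this square and the next two spells out the monad of [p]: its unit at [γ], the
    action of the algebra of [π] (for [π = p ∘ γ] the multiplication at [γ]), and its effect on the
    morphism [f]. *)
Lemma unit_square (x : C) (γ : Hom x c) : p ∘ γ = p ∘ γ ∘ idm x.
Proof. now rewrite comp_idr. Qed.

Lemma mult_square (x : C) (π : Hom x b) :
  p ∘ pb_fst P p (p ∘ pb_fst P p π) =
  π ∘ (pb_snd P p π ∘ pb_snd P p (p ∘ pb_fst P p π)).
Proof. now rewrite pb_square, !comp_assoc, pb_square. Qed.

Lemma map_square (x y : C) (γ : Hom x c) (δ : Hom y c) (f : Hom x y) :
  δ ∘ f = γ -> p ∘ pb_fst P p (p ∘ γ) = p ∘ δ ∘ (f ∘ pb_snd P p (p ∘ γ)).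
Proof. intros <-; now rewrite pb_square, !comp_assoc. Qed.

Definition epi (x y : C) (f : Hom x y) : Prop :=
  forall (z : C) (g h : Hom y z), g ∘ f = h ∘ f -> g = h.

Context (p_epi : forall (x : C) (π : Hom x b), epi (pb_snd P p π)).

Lemma comparison_faithful : faithful K.
Proof.
  intros [y π] [y' π'] k k' e; apply sig_eq, (p_epi (π := π)).
  apply (f_equal (@proj1_sig _ _)), (f_equal (@proj1_sig _ _)) in e; simpl in e.
  apply (f_equal (comp (pb_snd P p π'))) in e.
  now rewrite !pb_snd_pair in e.
Qed.

(** The iterated pullback is the kernel pair of [pb_snd P p π] in another guise: on elements its two
    maps send [(c', (c, x))] to [(c', x)] and to [(c, x)]. Together with [p_epi] the condition says
    that [pb_snd P p π] is their coequalizer. *)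
Definition pullbacks_coequalize : Prop :=
  forall (x z : C) (π : Hom x b) (g : Hom (pb P p π) z),
    g ∘ pb_pair P (mult_square π) = g ∘ pb_snd P p (p ∘ pb_fst P p π) ->
    exists k : Hom x z, k ∘ pb_snd P p π = g.

(** Equivariance of [h] is what makes [pb_snd P p π' ∘ h] coequalize the two maps; the induced [k]
    is the preimage of [h]. *)
Lemma comparison_full : pullbacks_coequalize -> full K.
Proof.
  intros p_coeq [y π] [y' π'] [[h eh] Hh]; simpl in h, eh.
  assert (e : h ∘ pb_pair P (mult_square π) =
    pb_pair P (mult_square π') ∘ pb_pair P (map_square eh)).
  { pose proof (f_equal (@proj1_sig _ _) Hh) as e; simpl in e.
    (* The pairings in [e] differ from the desired ones only in the proofs that their squares
       commute. *)
    etransitivity; [|etransitivity; [exact e|]];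
      f_equal; f_equal; apply proof_irrelevance. }
  destruct (p_coeq _ _ π (pb_snd P p π' ∘ h)) as [k Hk].
  { apply (f_equal (comp (pb_snd P p π'))) in e.
    rewrite comp_assoc in e; rewrite e, comp_assoc, pb_snd_pair.
    rewrite <- comp_assoc, pb_snd_pair; apply comp_assoc. }
  assert (ek : π' ∘ k = π).
  { apply (p_epi (π := π)); rewrite <- comp_assoc, Hk, comp_assoc, <- pb_square,
      <- comp_assoc, eh.
    apply pb_square. }
  exists (exist _ k ek); apply sig_eq, sig_eq; simpl; apply pb_ext.
  - rewrite pb_fst_pair; exact (eq_sym eh).
  - rewrite pb_snd_pair; exact Hk.
Qed.

(** The hypotheses unfold an algebra [ξ] on [γ]: a map over [c], the unit law and associativity. The
    conclusion asks for an object over [b] whose pullback is [γ], by a map [q] that does not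
    distinguish a point from its transports. *)
Definition algebras_descend : Prop :=
  forall (x : C) (γ : Hom x c) (ξ : Hom (pb P p (p ∘ γ)) x)
    (ex : γ ∘ ξ = pb_fst P p (p ∘ γ)),
    ξ ∘ pb_pair P (unit_square γ) = idm x ->
    ξ ∘ pb_pair P (mult_square (p ∘ γ)) = ξ ∘ pb_pair P (map_square ex) ->
    exists (y : C) (π : Hom y b) (q : Hom x y) (e : p ∘ γ = π ∘ q),
      q ∘ ξ = q ∘ pb_snd P p (p ∘ γ) /\ is_iso (pb_pair P e).

(** The equation for [q] makes the map from [x] to the pullback of [π] equivariant; being invertible
    in [C], it is an isomorphism of algebras. *)
Lemma comparison_essentially_surjective : algebras_descend -> essentially_surjective K.
Proof.
  intros Heff [[x γ] [ξ ex] Hret Hmult]; simpl in ξ, ex.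
  pose proof (f_equal (@proj1_sig _ _) Hret) as Hret'.
  pose proof (f_equal (@proj1_sig _ _) Hmult) as Hmult'.
  simpl in Hret', Hmult'.
  destruct (Heff x γ ξ ex) as (y & π & q & e & Hq & Hiso).
  - etransitivity; [|exact Hret']; f_equal; f_equal; apply proof_irrelevance.
  - etransitivity; [|etransitivity; [exact Hmult'|]];
      f_equal; f_equal; apply proof_irrelevance.
  - exists (existT _ y π).
    pose proof (pb_fst_pair P e) as Ee.
    assert (Hh : pb_pair P e ∘ ξ =
      pb_pair P (mult_square π) ∘ pb_pair P (map_square Ee)).
    { apply pb_ext; rewrite !comp_assoc.
      - rewrite 3!pb_fst_pair; exact ex.
      - rewrite 2!pb_snd_pair, <- comp_assoc, pb_snd_pair, comp_assoc, pb_snd_pair.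
        exact Hq. }
    unshelve edestruct (@algebra_iso _ (adj_monad (postcomp_adjunction P p))
      (Build_Algebra Hret Hmult) (K (existT _ y π))) as [g [g1 g2]].
    + exists (exist _ (pb_pair P e) Ee).
      apply sig_eq; simpl; etransitivity; [|etransitivity; [exact Hh|]];
        f_equal; f_equal; apply proof_irrelevance.
    + apply slice_iso; exact Hiso.
    + exists g; eexists; split; [exact g2 | exact g1].
Qed.

Lemma effective_descent_intro :
  pullbacks_coequalize -> algebras_descend -> is_effective_descent P p.
Proof.
  intros H1 H2; exists (postcomp p), (postcomp_adjunction P p).
  apply equivalence_intro.
  - exact comparison_faithful.
  - exact (comparison_full H1).
  - exact (comparison_essentially_surjective H2).
Qed.

End DescentCriterion.

(** * Quotients of 2-categories *)

(* Otherwise the kernel may unfold both sides of [g ∘ f = two_functor_comp g f] to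
   record constructors, with a blow-up exponential in the depth of the composite. *)
Strategy 1000 [two_functor_comp two_functor_id two_pullback
  two_pullback_fst two_pullback_snd two_pullback_pair].

(* Injectivity on objects makes horizontal composability in the target lift
   automatically, so only vertical composites need a condition; triples rather
   than pairs are what associativity in a quotient requires. *)
Record vertically_surjective (X Y : TwoCategory) (q : TwoFunctor X Y) : Prop := {
  vs_obj_inj : forall x x', F0 q x = F0 q x' -> x = x';
  vs_triple : forall c b a : cell Y, vcod a = vdom b -> vcod b = vdom c ->
    exists c' b' a' : cell X, vcod a' = vdom b' /\ vcod b' = vdom c' /\
      F2 q c' = c /\ F2 q b' = b /\ F2 q a' = a
}.

Section VerticallySurjective.
Context (X Y : TwoCategory) (q : TwoFunctor X Y) (Hq : vertically_surjective q).

(** An identity 2-cell on top completes the pair to a triple. *)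
Lemma vs_pair (b a : cell Y) : vcod a = vdom b ->
  exists b' a' : cell X, vcod a' = vdom b' /\ F2 q b' = b /\ F2 q a' = a.
Proof.
  intros e; destruct (vs_triple Hq (c := id2 (vcod b)) e) as (c' & b' & a' & H).
  - now rewrite vdom_id2.
  - exists b', a'; tauto.
Qed.

Lemma vs_cell (b : cell Y) : exists a, F2 q a = b.
Proof.
  destruct (@vs_pair b (id2 (vdom b))) as (b' & a' & _ & H & _); [apply vcod_id2|].
  now exists b'.
Qed.

Lemma vs_arr (g : arr Y) : exists f, F1 q f = g.
Proof.
  destruct (vs_cell (id2 g)) as [a e]; exists (vdom a).
  now rewrite <- F_vdom, e, vdom_id2.
Qed.

Lemma vs_obj (y : obj Y) : exists x, F0 q x = y.
Proof.
  destruct (vs_arr (id1 y)) as [f e]; exists (dom f).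
  now rewrite <- F_dom, e, dom_id1.
Qed.

Lemma vs_comp1 (g f : arr X) : cod (F1 q f) = dom (F1 q g) -> cod f = dom g.
Proof. rewrite F_cod, F_dom; apply (vs_obj_inj Hq). Qed.

Lemma vs_hcomp (b a : cell X) :
  cod (vdom (F2 q a)) = dom (vdom (F2 q b)) -> cod (vdom a) = dom (vdom b).
Proof. rewrite !F_vdom; apply vs_comp1. Qed.

Lemma vs_epi (Z : TwoCategory) (G H : TwoFunctor Y Z) :
  two_functor_comp G q = two_functor_comp H q -> G = H.
Proof.
  intros e; apply two_functor_eq.
  - intros y; destruct (vs_obj y) as [x <-]; exact (f_equal (fun K => F0 K x) e).
  - intros y; destruct (vs_arr y) as [x <-]; exact (f_equal (fun K => F1 K x) e).
  - intros y; destruct (vs_cell y) as [x <-]; exact (f_equal (fun K => F2 K x) e).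
Qed.

(** The values of [H] are those of [G] at chosen preimages. Each law is checked at preimages
    composable in [X]: injectivity on objects gives them for [comp1] and [hcomp], and [vs_pair] for
    [vcomp]. *)
Lemma vs_descend (Z : TwoCategory) (G : TwoFunctor X Z) :
  (forall f f', F1 q f = F1 q f' -> F1 G f = F1 G f') ->
  (forall a a', F2 q a = F2 q a' -> F2 G a = F2 G a') ->
  exists H : TwoFunctor Y Z, two_functor_comp H q = G.
Proof.
  intros G1 G2.
  destruct (exists_section vs_obj) as [s0 Hs0], (exists_section vs_arr) as [s1 Hs1],
    (exists_section vs_cell) as [s2 Hs2].
  assert (H0 : forall x, F0 G (s0 (F0 q x)) = F0 G x)
    by (intros; f_equal; apply (vs_obj_inj Hq), Hs0).
  assert (H1 : forall x, F1 G (s1 (F1 q x)) = F1 G x) by (intros; apply G1, Hs1).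
  assert (H2 : forall x, F2 G (s2 (F2 q x)) = F2 G x) by (intros; apply G2, Hs2).
  unshelve eexists (@Build_TwoFunctor Y Z (fun y => F0 G (s0 y)) (fun y => F1 G (s1 y))
    (fun y => F2 G (s2 y)) _ _ _ _ _ _ _ _ _).
  - intros f; destruct (vs_arr f) as [f' <-]; rewrite H1, !F_dom, H0; reflexivity.
  - intros f; destruct (vs_arr f) as [f' <-]; rewrite H1, !F_cod, H0; reflexivity.
  - intros a; destruct (vs_cell a) as [a' <-]; rewrite H2, !F_vdom, H1; reflexivity.
  - intros a; destruct (vs_cell a) as [a' <-]; rewrite H2, !F_vcod, H1; reflexivity.
  - intros x; destruct (vs_obj x) as [x' <-]; rewrite <- F_id1, H1, H0; apply F_id1.
  - intros f; destruct (vs_arr f) as [f' <-]; rewrite <- F_id2, H2, H1; apply F_id2.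
  - intros g f e; destruct (vs_arr f) as [f' <-], (vs_arr g) as [g' <-].
    pose proof (vs_comp1 e) as e1; rewrite <- (F_comp1 q e1 e), !H1; intros e'.
    rewrite (F_comp1 G e1 (F1_composable G e1)); now apply comp1_eq.
  - intros b a e; destruct (vs_pair e) as (b' & a' & e1 & <- & <-).
    rewrite <- (F_vcomp q e1 e), !H2; intros e'.
    rewrite (F_vcomp G e1 (F2_vcomposable G e1)); now apply vcomp_eq.
  - intros b a e; destruct (vs_cell a) as [a' <-], (vs_cell b) as [b' <-].
    pose proof (vs_hcomp e) as e1; rewrite <- (F_hcomp q e1 e), !H2; intros e'.
    rewrite (F_hcomp G e1 (F2_hcomposable G e1)); now apply hcomp_eq.
  - apply two_functor_eq; assumption.
Qed.

End VerticallySurjective.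

(** * Sets of equivalence classes, congruences and the quotient 2-category *)

Section Classes.
Context (A : Type) (R : A -> A -> Prop).

Definition classes : Type := {P : A -> Prop | exists x, P = R x}.

Definition class (x : A) : classes := exist _ (R x) (ex_intro _ x eq_refl).

Lemma class_surj (P : classes) : exists x, class x = P.
Proof. destruct P as [P [x ->]]; now exists x. Qed.

Definition repr (P : classes) : A :=
  proj1_sig (constructive_indefinite_description _ (class_surj P)).

Lemma class_repr (P : classes) : class (repr P) = P.
Proof. exact (proj2_sig (constructive_indefinite_description _ (class_surj P))). Qed.

Record equivalence : Prop := {
  equiv_refl : forall x, R x x;
  equiv_sym : forall x y, R x y -> R y x;
  equiv_trans : forall x y z, R x y -> R y z -> R x z
}.

Lemma class_eq (HR : equivalence) (x y : A) : class x = class y <-> R x y.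
Proof.
  split; intros e.
  - apply (f_equal (@proj1_sig _ _)) in e; simpl in e; rewrite e; apply (equiv_refl HR).
  - apply sig_eq; simpl; apply functional_extensionality; intros z.
    apply propositional_extensionality; split; intros H.
    + exact (equiv_trans HR (equiv_sym HR e) H).
    + exact (equiv_trans HR e H).
Qed.

Lemma repr_class (HR : equivalence) (x : A) : R (repr (class x)) x.
Proof. apply (class_eq HR), class_repr. Qed.

End Classes.

(** Objects are not identified, hence the equalities in [cg_dom] and [cg_cod]. By [cg_triple],
    2-cells composable up to [R1] have representatives composable in [X]; without such a condition
    the quotient would have to contain new formal composites. *)
Record congruence (X : TwoCategory) (R1 : arr X -> arr X -> Prop)
  (R2 : cell X -> cell X -> Prop) : Prop := {
  cg_equiv1 : equivalence R1;
  cg_equiv2 : equivalence R2;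
  cg_dom : forall f f', R1 f f' -> dom f = dom f';
  cg_cod : forall f f', R1 f f' -> cod f = cod f';
  cg_vdom : forall a a', R2 a a' -> R1 (vdom a) (vdom a');
  cg_vcod : forall a a', R2 a a' -> R1 (vcod a) (vcod a');
  cg_id2 : forall f f', R1 f f' -> R2 (id2 f) (id2 f');
  cg_comp1 : forall g g' f f' e e', R1 g g' -> R1 f f' ->
    R1 (comp1 g f e) (comp1 g' f' e');
  cg_vcomp : forall b b' a a' e e', R2 b b' -> R2 a a' ->
    R2 (vcomp b a e) (vcomp b' a' e');
  cg_hcomp : forall b b' a a' e e', R2 b b' -> R2 a a' ->
    R2 (hcomp b a e) (hcomp b' a' e');
  cg_triple : forall c b a, R1 (vcod a) (vdom b) -> R1 (vcod b) (vdom c) ->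
    exists c' b' a', vcod a' = vdom b' /\ vcod b' = vdom c' /\
      R2 c' c /\ R2 b' b /\ R2 a' a
}.

Section Quotient.
Context (X : TwoCategory) (R1 : arr X -> arr X -> Prop) (R2 : cell X -> cell X -> Prop).
Context (HR : congruence R1 R2).

Notation Y1 := (classes R1).
Notation Y2 := (classes R2).
Notation q1 := (class R1).
Notation q2 := (class R2).

Lemma q1_eq f f' : q1 f = q1 f' <-> R1 f f'.
Proof. apply class_eq, (cg_equiv1 HR). Qed.

Lemma q2_eq a a' : q2 a = q2 a' <-> R2 a a'.
Proof. apply class_eq, (cg_equiv2 HR). Qed.

Definition qdom (f : Y1) : obj X := dom (repr f).
Definition qcod (f : Y1) : obj X := cod (repr f).
Definition qvdom (a : Y2) : Y1 := q1 (vdom (repr a)).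
Definition qvcod (a : Y2) : Y1 := q1 (vcod (repr a)).

Lemma qdom_class f : qdom (q1 f) = dom f.
Proof. apply (cg_dom HR), repr_class, (cg_equiv1 HR). Qed.

Lemma qcod_class f : qcod (q1 f) = cod f.
Proof. apply (cg_cod HR), repr_class, (cg_equiv1 HR). Qed.

Lemma qvdom_class a : qvdom (q2 a) = q1 (vdom a).
Proof. apply q1_eq, (cg_vdom HR), repr_class, (cg_equiv2 HR). Qed.

Lemma qvcod_class a : qvcod (q2 a) = q1 (vcod a).
Proof. apply q1_eq, (cg_vcod HR), repr_class, (cg_equiv2 HR). Qed.

Lemma qcomposable g f : qcod (q1 f) = qdom (q1 g) -> cod f = dom g.
Proof. now rewrite qcod_class, qdom_class. Qed.

Lemma qhcomposable b a :
  qcod (qvdom (q2 a)) = qdom (qvdom (q2 b)) -> cod (vdom a) = dom (vdom b).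
Proof. rewrite !qvdom_class; apply qcomposable. Qed.

Definition qcomp1 (g f : Y1) (e : qcod f = qdom g) : Y1 := q1 (comp1 (repr g) (repr f) e).

Lemma qcomp1_class g f g' f' (e : qcod f = qdom g) e' :
  q1 g' = g -> q1 f' = f -> qcomp1 e = q1 (comp1 g' f' e').
Proof.
  intros <- <-; apply q1_eq, (cg_comp1 HR); apply repr_class, (cg_equiv1 HR).
Qed.

Lemma repr_qhcomposable (b a : Y2) :
  qcod (qvdom a) = qdom (qvdom b) -> cod (vdom (repr a)) = dom (vdom (repr b)).
Proof. intros e; apply qhcomposable; now rewrite !class_repr. Qed.

Definition qhcomp (b a : Y2) (e : qcod (qvdom a) = qdom (qvdom b)) : Y2 :=
  q2 (hcomp (repr b) (repr a) (repr_qhcomposable e)).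

Lemma qhcomp_class b a b' a' (e : qcod (qvdom a) = qdom (qvdom b)) e' :
  q2 b' = b -> q2 a' = a -> qhcomp e = q2 (hcomp b' a' e').
Proof.
  intros <- <-; apply q2_eq, (cg_hcomp HR); apply repr_class, (cg_equiv2 HR).
Qed.

Lemma qtriple (c b a : Y2) : qvcod a = qvdom b -> qvcod b = qvdom c ->
  exists c' b' a', vcod a' = vdom b' /\ vcod b' = vdom c' /\
      q2 c' = c /\ q2 b' = b /\ q2 a' = a.
Proof.
  destruct (class_surj a) as [a0 <-], (class_surj b) as [b0 <-], (class_surj c) as [c0 <-].
  rewrite !qvcod_class, !qvdom_class, !q1_eq; intros e1 e2.
  destruct (cg_triple HR e1 e2) as (c' & b' & a' & H1 & H2 & H3 & H4 & H5).
  exists c', b', a'; rewrite !q2_eq; tauto.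
Qed.

Lemma qpair (b a : Y2) : qvcod a = qvdom b ->
  exists b' a', vcod a' = vdom b' /\ q2 b' = b /\ q2 a' = a.
Proof.
  intros e; destruct (@qtriple (q2 (id2 (vcod (repr b)))) b a e) as (c' & b' & a' & H).
  - rewrite qvdom_class, vdom_id2; reflexivity.
  - exists b', a'; tauto.
Qed.

(** Chosen representatives of composable classes need not be composable, so the composite is
    characterized by its value at all composable representatives. *)
Lemma qvcomp_exists (b a : Y2) : qvcod a = qvdom b ->
  exists y : Y2, forall b' a' e, q2 b' = b -> q2 a' = a -> y = q2 (vcomp b' a' e).
Proof.
  intros e; destruct (qpair e) as (b0 & a0 & e0 & <- & <-).
  exists (q2 (vcomp b0 a0 e0)); intros b' a' e'; rewrite !q2_eq; intros H1 H2.
  apply (cg_vcomp HR); now apply (equiv_sym (cg_equiv2 HR)).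
Qed.

Definition qvcomp (b a : Y2) (e : qvcod a = qvdom b) : Y2 :=
  proj1_sig (constructive_indefinite_description _ (qvcomp_exists e)).

Lemma qvcomp_class b a b' a' (e : qvcod a = qvdom b) e' :
  q2 b' = b -> q2 a' = a -> qvcomp e = q2 (vcomp b' a' e').
Proof. exact (proj2_sig (constructive_indefinite_description _ (qvcomp_exists e)) b' a' e'). Qed.

Lemma q1_surj (f : Y1) : exists f', q1 f' = f.
Proof. apply class_surj. Qed.

Lemma q2_surj (a : Y2) : exists a', q2 a' = a.
Proof. apply class_surj. Qed.

Definition qid1 (x : obj X) : Y1 := q1 (id1 x).
Definition qid2 (f : Y1) : Y2 := q2 (id2 (repr f)).

Lemma qid2_class f : q2 (id2 f) = qid2 (q1 f).
Proof.
  apply q2_eq, (cg_id2 HR), (equiv_sym (cg_equiv1 HR)), repr_class, (cg_equiv1 HR).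
Qed.

End Quotient.

Section QuotientTwoCategory.
Context (X : TwoCategory) (R1 : arr X -> arr X -> Prop) (R2 : cell X -> cell X -> Prop).
Context (HR : congruence R1 R2).

(** Each law is an instance of the same law in [X], once all classes involved have been given
    representatives that are composable in [X]. *)
Definition quotient : TwoCategory.
Proof.
  refine {| obj := obj X; arr := classes R1; cell := classes R2;
    dom := @qdom X R1; cod := @qcod X R1; vdom := @qvdom X R1 R2; vcod := @qvcod X R1 R2;
    id1 := @qid1 X R1; id2 := @qid2 X R1 R2; comp1 := @qcomp1 X R1;
    vcomp := @qvcomp X R1 R2 HR; hcomp := @qhcomp X R1 R2 HR |}.
  - abstract (intros a; destruct (q2_surj a) as [a' <-];
      rewrite (qvcod_class HR), (qvdom_class HR), !(qdom_class HR); apply dom_vcod).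
  - abstract (intros a; destruct (q2_surj a) as [a' <-];
      rewrite (qvcod_class HR), (qvdom_class HR), !(qcod_class HR); apply cod_vcod).
  - abstract (intros x; unfold qid1; rewrite (qdom_class HR); apply dom_id1).
  - abstract (intros x; unfold qid1; rewrite (qcod_class HR); apply cod_id1).
  - abstract (intros; unfold qcomp1; rewrite (qdom_class HR); apply dom_comp1).
  - abstract (intros; unfold qcomp1; rewrite (qcod_class HR); apply cod_comp1).
  - abstract (intros f; destruct (q1_surj f) as [f' <-]; intros e;
      assert (e' : cod f' = dom (id1 (cod f'))) by (now rewrite dom_id1);
      rewrite (qcomp1_class HR e e'
        (f_equal (qid1 R1) (eq_sym (qcod_class HR f'))) eq_refl); f_equal; apply comp1_idl).
  - abstract (intros f; destruct (q1_surj f) as [f' <-]; intros e;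
      assert (e' : cod (id1 (dom f')) = dom f') by (now rewrite cod_id1);
      rewrite (qcomp1_class HR e e' eq_refl
        (f_equal (qid1 R1) (eq_sym (qdom_class HR f')))); f_equal; apply comp1_idr).
  - intros h g f; destruct (q1_surj f) as [f' <-], (q1_surj g) as [g' <-],
      (q1_surj h) as [h' <-]; intros e1 e2 e3 e4.
    assert (d1 : cod f' = dom g') by exact (qcomposable HR e1).
    assert (d3 : cod g' = dom h') by exact (qcomposable HR e3).
    assert (d2 : cod (comp1 g' f' d1) = dom h') by (now rewrite cod_comp1).
    assert (d4 : cod f' = dom (comp1 h' g' d3)) by (now rewrite dom_comp1).
    rewrite (qcomp1_class HR e2 d2 eq_refl (eq_sym (qcomp1_class HR e1 d1 eq_refl eq_refl))).
    rewrite (qcomp1_class HR e4 d4 (eq_sym (qcomp1_class HR e3 d3 eq_refl eq_refl)) eq_refl).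
    f_equal; apply comp1_assoc.
  - abstract (intros f; destruct (q1_surj f) as [f' <-]; rewrite <- (qid2_class HR),
      (qvdom_class HR); f_equal; apply vdom_id2).
  - abstract (intros f; destruct (q1_surj f) as [f' <-]; rewrite <- (qid2_class HR),
      (qvcod_class HR); f_equal; apply vcod_id2).
  - intros b a e; destruct (qpair HR e) as (b' & a' & e' & Hb & Ha).
    rewrite (qvcomp_class HR e e' Hb Ha), <- Ha, !(qvdom_class HR); f_equal; apply vdom_vcomp.
  - intros b a e; destruct (qpair HR e) as (b' & a' & e' & Hb & Ha).
    rewrite (qvcomp_class HR e e' Hb Ha), <- Hb, !(qvcod_class HR); f_equal; apply vcod_vcomp.
  - intros a; destruct (q2_surj a) as [a' <-]; intros e;
    assert (e' : vcod a' = vdom (id2 (vcod a'))) by (now rewrite vdom_id2).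
    assert (E : class R2 (id2 (vcod a')) = qid2 R2 (qvcod R1 (class R2 a')))
      by (now rewrite (qid2_class HR), (qvcod_class HR)).
    rewrite (qvcomp_class HR e e' E eq_refl); f_equal; apply vcomp_idl.
  - intros a; destruct (q2_surj a) as [a' <-]; intros e;
    assert (e' : vcod (id2 (vdom a')) = vdom a') by (now rewrite vcod_id2).
    assert (E : class R2 (id2 (vdom a')) = qid2 R2 (qvdom R1 (class R2 a')))
      by (now rewrite (qid2_class HR), (qvdom_class HR)).
    rewrite (qvcomp_class HR e e' eq_refl E); f_equal; apply vcomp_idr.
  - intros c b a e1 e2 e3 e4.
    (* A single composable triple of representatives serves both bracketings. *)
    destruct (qtriple HR e1 e3) as (c' & b' & a' & d1 & d3 & Hc & Hb & Ha).
    assert (d2 : vcod (vcomp b' a' d1) = vdom c') by (now rewrite vcod_vcomp).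
    assert (d4 : vcod a' = vdom (vcomp c' b' d3)) by (now rewrite vdom_vcomp).
    rewrite (qvcomp_class HR e2 d2 Hc (eq_sym (qvcomp_class HR e1 d1 Hb Ha))).
    rewrite (qvcomp_class HR e4 d4 (eq_sym (qvcomp_class HR e3 d3 Hc Hb)) Ha).
    f_equal; apply vcomp_assoc.
  - intros b a; destruct (q2_surj a) as [a' <-], (q2_surj b) as [b' <-]; intros e.
    assert (e' : cod (vdom a') = dom (vdom b'))
      by exact (qhcomposable HR e).
    rewrite (qhcomp_class HR e e' eq_refl eq_refl), (qvdom_class HR), vdom_hcomp.
    symmetry; apply (qcomp1_class HR); symmetry; apply (qvdom_class HR).
  - intros b a; destruct (q2_surj a) as [a' <-], (q2_surj b) as [b' <-]; intros e e0.
    assert (e' : cod (vdom a') = dom (vdom b'))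
      by exact (qhcomposable HR e).
    assert (e0' : cod (vcod a') = dom (vcod b')) by (now rewrite cod_vcod, dom_vcod).
    rewrite (qhcomp_class HR e e' eq_refl eq_refl), (qvcod_class HR), (vcod_hcomp e' e0').
    symmetry; apply (qcomp1_class HR); symmetry; apply (qvcod_class HR).
  - intros a; destruct (q2_surj a) as [a' <-]. intros e.
    assert (e' : cod (vdom a') = dom (vdom (id2 (id1 (cod (vdom a'))))))
      by (now rewrite vdom_id2, dom_id1).
    assert (E : class R2 (id2 (id1 (cod (vdom a')))) =
      qid2 R2 (qid1 R1 (qcod (qvdom R1 (class R2 a')))))
      by (now rewrite (qid2_class HR), (qvdom_class HR), (qcod_class HR)).
    rewrite (qhcomp_class HR e e' E eq_refl); f_equal; apply hcomp_idl.
  - intros a; destruct (q2_surj a) as [a' <-]. intros e.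
    assert (e' : cod (vdom (id2 (id1 (dom (vdom a'))))) = dom (vdom a'))
      by (now rewrite vdom_id2, cod_id1).
    assert (E : class R2 (id2 (id1 (dom (vdom a')))) =
      qid2 R2 (qid1 R1 (qdom (qvdom R1 (class R2 a')))))
      by (now rewrite (qid2_class HR), (qvdom_class HR), (qdom_class HR)).
    rewrite (qhcomp_class HR e e' eq_refl E); f_equal; apply hcomp_idr.
  - intros c b a; destruct (q2_surj a) as [a' <-], (q2_surj b) as [b' <-],
      (q2_surj c) as [c' <-]; intros e1 e2 e3 e4.
    assert (d1 : cod (vdom a') = dom (vdom b'))
      by exact (qhcomposable HR e1).
    assert (d3 : cod (vdom b') = dom (vdom c'))
      by exact (qhcomposable HR e3).
    assert (d2 : cod (vdom (hcomp b' a' d1)) = dom (vdom c'))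
      by (now rewrite vdom_hcomp, cod_comp1).
    assert (d4 : cod (vdom a') = dom (vdom (hcomp c' b' d3)))
      by (now rewrite vdom_hcomp, dom_comp1).
    rewrite (qhcomp_class HR e2 d2 eq_refl (eq_sym (qhcomp_class HR e1 d1 eq_refl eq_refl))).
    rewrite (qhcomp_class HR e4 d4 (eq_sym (qhcomp_class HR e3 d3 eq_refl eq_refl)) eq_refl).
    f_equal; apply hcomp_assoc.
  - intros g f; destruct (q1_surj f) as [f' <-], (q1_surj g) as [g' <-]; intros e e0.
    assert (d0 : cod f' = dom g') by exact (qcomposable HR e0).
    assert (d : cod (vdom (id2 f')) = dom (vdom (id2 g'))) by (now rewrite !vdom_id2).
    rewrite (qhcomp_class HR e d (qid2_class HR _) (qid2_class HR _)).
    rewrite (qcomp1_class HR e0 d0 eq_refl eq_refl), <- (qid2_class HR).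
    f_equal; apply hcomp_id2.
  - intros d c b a e1 e2 e3 e4 e5 e6.
    (* The two vertical pairs are lifted independently. Their horizontal composability follows since
       objects are not identified, and [h1] and [h2] make the horizontal composites vertically
       composable. *)
    destruct (qpair HR e1) as (d' & c' & h1 & Hd & Hc).
    destruct (qpair HR e2) as (b' & a' & h2 & Hb & Ha).
    assert (h4 : cod (vdom b') = dom (vdom d'))
      by (apply (qhcomposable HR); rewrite Hb, Hd; exact e4).
    assert (h5 : cod (vdom a') = dom (vdom c'))
      by (apply (qhcomposable HR); rewrite Ha, Hc; exact e5).
    assert (h3 : cod (vdom (vcomp b' a' h2)) = dom (vdom (vcomp d' c' h1)))
      by (now rewrite !vdom_vcomp).
    assert (h6 : vcod (hcomp c' a' h5) = vdom (hcomp d' b' h4)).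
    { rewrite vdom_hcomp.
      assert (k : cod (vcod a') = dom (vcod c')) by (now rewrite cod_vcod, dom_vcod).
      rewrite (vcod_hcomp h5 k); apply comp1_eq; congruence. }
    rewrite (qhcomp_class HR e3 h3 (eq_sym (qvcomp_class HR e1 h1 Hd Hc))
      (eq_sym (qvcomp_class HR e2 h2 Hb Ha))).
    rewrite (qvcomp_class HR e6 h6 (eq_sym (qhcomp_class HR e4 h4 Hd Hb))
      (eq_sym (qhcomp_class HR e5 h5 Hc Ha))).
    f_equal; apply interchange.
Defined.

Definition quotient_map : TwoFunctor X quotient.
Proof.
  refine (@Build_TwoFunctor X quotient (fun x => x) (class R1) (class R2)
            _ _ _ _ _ _ _ _ _).
  - exact (qdom_class HR).
  - exact (qcod_class HR).
  - exact (qvdom_class HR).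
  - exact (qvcod_class HR).
  - reflexivity.
  - exact (qid2_class HR).
  - abstract (intros; symmetry; now apply (qcomp1_class HR)).
  - abstract (intros; symmetry; now apply (qvcomp_class HR)).
  - abstract (intros; symmetry; now apply (qhcomp_class HR)).
Defined.

Lemma quotient_map_arr f f' : F1 quotient_map f = F1 quotient_map f' <-> R1 f f'.
Proof. apply class_eq, (cg_equiv1 HR). Qed.

Lemma quotient_map_cell a a' : F2 quotient_map a = F2 quotient_map a' <-> R2 a a'.
Proof. apply class_eq, (cg_equiv2 HR). Qed.

Lemma quotient_map_vertically_surjective : vertically_surjective quotient_map.
Proof. split; [now intros | exact (qtriple HR)]. Qed.

End QuotientTwoCategory.

(** * Isomorphisms of 2-categories, and pullbacks of vertically surjective 2-functors *)

Lemma bijective_iso (A B : TwoCat) (F : Hom A B) :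
  (forall x x', F0 F x = F0 F x' -> x = x') -> (forall y, exists x, F0 F x = y) ->
  (forall x x', F1 F x = F1 F x' -> x = x') -> (forall y, exists x, F1 F x = y) ->
  (forall x x', F2 F x = F2 F x' -> x = x') -> (forall y, exists x, F2 F x = y) ->
  is_iso F.
Proof.
  intros i0 s0 i1 s1 i2 s2.
  assert (HF : vertically_surjective F).
  { split; [exact i0|]; intros c b a.
    destruct (s2 c) as [c' <-], (s2 b) as [b' <-], (s2 a) as [a' <-].
    rewrite !F_vcod, !F_vdom; intros e1%i1 e2%i1.
    now exists c', b', a'. }
  (* The inverse is the identity of [A], descended along [F]. *)
  destruct (vs_descend HF (G := two_functor_id A)) as [G HG].
  - intros f f' e; now apply i1.
  - intros f f' e; now apply i2.
  - exists G; split; [exact HG|].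
    apply (vs_epi HF), two_functor_eq.
    + exact (fun x => f_equal (F0 F) (f_equal (fun K => F0 K x) HG)).
    + exact (fun x => f_equal (F1 F) (f_equal (fun K => F1 K x) HG)).
    + exact (fun x => f_equal (F2 F) (f_equal (fun K => F2 K x) HG)).
Qed.

Lemma iso_bijective (A B : TwoCat) (F : Hom A B) : is_iso F ->
  (forall x x', F0 F x = F0 F x' -> x = x') /\ (forall y, exists x, F0 F x = y) /\
  (forall x x', F1 F x = F1 F x' -> x = x') /\ (forall y, exists x, F1 F x = y) /\
  (forall x x', F2 F x = F2 F x' -> x = x') /\ (forall y, exists x, F2 F x = y).
Proof.
  intros [G [e1 e2]].
  assert (Hbij : forall (X Y : Type) (f : X -> Y) (g : Y -> X),
    (forall x, g (f x) = x) -> (forall y, f (g y) = y) ->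
    (forall x x', f x = f x' -> x = x') /\ (forall y, exists x, f x = y)).
  { intros X Y f g H1 H2; split.
    - intros x x' e; now rewrite <- (H1 x), e, H1.
    - intros y; now exists (g y). }
  destruct (Hbij _ _ (F0 F) (F0 G) (fun x => f_equal (fun K => F0 K x) e1)
    (fun x => f_equal (fun K => F0 K x) e2)).
  destruct (Hbij _ _ (F1 F) (F1 G) (fun x => f_equal (fun K => F1 K x) e1)
    (fun x => f_equal (fun K => F1 K x) e2)).
  destruct (Hbij _ _ (F2 F) (F2 G) (fun x => f_equal (fun K => F2 K x) e1)
    (fun x => f_equal (fun K => F2 K x) e2)).
  tauto.
Qed.

Lemma vs_pullback (A B C : TwoCat) (p : Hom A C) (g : Hom B C) :
  vertically_surjective p -> vertically_surjective (two_pullback_snd p g).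
Proof.
  intros Hp; split.
  - intros x x' e; apply fp_ext; [|exact e].
    apply (vs_obj_inj Hp); rewrite !fp_square; now f_equal.
  - intros c b a e1 e2.
    destruct (vs_triple Hp (c := F2 g c) (b := F2 g b) (a := F2 g a))
      as (c' & b' & a' & d1 & d2 & Hc & Hb & Ha).
    + now apply F2_vcomposable.
    + now apply F2_vcomposable.
    + exists (fp Hc), (fp Hb), (fp Ha); repeat split; apply fp_ext; assumption.
Qed.

(** * A sufficient condition for effective descent *)

Section Transport.
Context (C B X : Type) (p : C -> B) (γ : X -> C)
  (t : fiber_product p (fun x => p (γ x)) -> X).

(* The axioms of an algebra for the monad of [p], on sets: [t (c, x)] is the
   transport of [x] to the fibre over [c]. *)
Record transport : Prop := {
  tr_over : forall z, γ (t z) = fp1 z;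
  tr_unit : forall z, fp1 z = γ (fp2 z) -> t z = fp2 z;
  tr_assoc : forall z z' z'', fp2 z' = t z -> fp1 z'' = fp1 z' -> fp2 z'' = fp2 z ->
    t z' = t z''
}.

Definition transported (x x' : X) : Prop := exists z, fp2 z = x /\ t z = x'.

Context (HT : transport).

Lemma transported_fibre x x' : transported x x' -> p (γ x) = p (γ x').
Proof. intros [z [<- <-]]; rewrite (tr_over HT); symmetry; apply fp_square. Qed.

Lemma transported_exists c x : p c = p (γ x) -> exists x', transported x x' /\ γ x' = c.
Proof.
  intros e; exists (t (fp (g := fun x => p (γ x)) e)); split.
  - now exists (fp (g := fun x => p (γ x)) e).
  - apply (tr_over HT).
Qed.

(** With [transported_exists], a class of [transported] meets each fibre of [γ] over the relevant
    points of [C] exactly once. This is why [X] is recovered as a pullback of its quotient. *)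
Lemma transported_eq x x' : transported x x' -> γ x = γ x' -> x = x'.
Proof.
  intros [z [<- <-]]; rewrite (tr_over HT); intros e.
  symmetry; now apply (tr_unit HT).
Qed.

Lemma transported_equivalence : equivalence transported.
Proof.
  split.
  - intros x; exists (fp (f := p) (g := fun x => p (γ x)) (x := γ x) (y := x) eq_refl).
    split; [reflexivity|]; now apply (tr_unit HT).
  - intros x x' Hx; pose proof (transported_fibre Hx) as e; destruct Hx as [z [<- <-]].
    exists (fp (g := fun x => p (γ x)) e); split; [reflexivity|].
    (* By associativity, carrying [t z] back to the point [γ (fp2 z)] amounts to transporting
       [fp2 z] to its own point, which the unit law makes trivial. *)
    set (u := fp (f := p) (g := fun x => p (γ x)) (x := γ (fp2 z)) (y := fp2 z) eq_refl).
    rewrite (tr_assoc HT (z := z) (z'' := u)); [|reflexivity..].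
    now rewrite (tr_unit HT).
  - intros x x' x'' Hx Hx'.
    pose proof (eq_trans (transported_fibre Hx) (transported_fibre Hx')) as e.
    destruct Hx as [z [<- <-]], Hx' as [z' [e' <-]].
    rewrite (tr_over HT) in e.
    exists (fp (g := fun x => p (γ x)) (eq_sym e)); split; [reflexivity|].
    symmetry; now apply (tr_assoc HT (z := z)).
Qed.

End Transport.

(** * Vertically surjective 2-functors are of effective descent *)

Section Descent.
Context (C B : TwoCat) (p : Hom C B) (Hp : vertically_surjective p).

Notation P := TwoCat_pullbacks.

Lemma vs_pullbacks_coequalize : pullbacks_coequalize P p.
Proof.
  intros Y Z π g; generalize (mult_square P p π); simpl; intros E e.
  apply (vs_descend (vs_pullback π Hp)); simpl; intros z z' ez.
  - assert (k : F1 p (fp1 z) = F1 p (fp1 z')) by (now rewrite !fp_square, ez).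
    (* The point [(fp1 z, z')] of the iterated pullback is sent to [z] by one of the two coequalized
       maps and to [z'] by the other. *)
    set (w := fp (f := F1 p) (g := F1 (two_functor_comp p (two_pullback_fst p π)))
      (y := z') k).
    transitivity (F1 g (F1 (two_pullback_pair E) w)).
    + f_equal; now apply fp_ext.
    + exact (f_equal (fun G : TwoFunctor
        (two_pullback p (two_functor_comp p (two_pullback_fst p π))) Z => F1 G w) e).
  - assert (k : F2 p (fp1 z) = F2 p (fp1 z')) by (now rewrite !fp_square, ez).
    set (w := fp (f := F2 p) (g := F2 (two_functor_comp p (two_pullback_fst p π)))
      (y := z') k).
    transitivity (F2 g (F2 (two_pullback_pair E) w)).
    + f_equal; now apply fp_ext.
    + exact (f_equal (fun G : TwoFunctor
        (two_pullback p (two_functor_comp p (two_pullback_fst p π))) Z => F2 G w) e).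
Qed.

Section Algebra.
Context (X : TwoCategory) (γ : TwoFunctor X C)
  (ξ : TwoFunctor (two_pullback p (two_functor_comp p γ)) X).
Context (T0 : transport (p := F0 p) (γ := F0 γ) (F0 ξ))
  (T1 : transport (p := F1 p) (γ := F1 γ) (F1 ξ))
  (T2 : transport (p := F2 p) (γ := F2 γ) (F2 ξ)).

Notation W := (two_pullback p (two_functor_comp p γ)).
Notation R1 := (transported (p := F1 p) (γ := F1 γ) (F1 ξ)).
Notation R2 := (transported (p := F2 p) (γ := F2 γ) (F2 ξ)).

(** Since [p] is injective on objects, an object can only be transported to its own point. *)
Lemma transport_obj z : F0 ξ z = fp2 z.
Proof.
  apply (tr_unit T0), (vs_obj_inj Hp); exact (fp_square z).
Qed.

Lemma transported_congruence : congruence R1 R2.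
Proof.
  pose proof (transported_equivalence T1) as E1.
  pose proof (transported_equivalence T2) as E2.
  assert (Hvdom : forall a a', R2 a a' -> R1 (vdom a) (vdom a')).
  { intros a a' [z [<- <-]]; exists (@vdom W z); split; [reflexivity|].
    symmetry; apply (F_vdom ξ). }
  assert (Hvcod : forall a a', R2 a a' -> R1 (vcod a) (vcod a')).
  { intros a a' [z [<- <-]]; exists (@vcod W z); split; [reflexivity|].
    symmetry; apply (F_vcod ξ). }
  split; try assumption.
  - intros f f' [z [<- <-]]; rewrite (F_dom ξ), transport_obj; reflexivity.
  - intros f f' [z [<- <-]]; rewrite (F_cod ξ), transport_obj; reflexivity.
  - intros f f' [z [<- <-]]; exists (@id2 W z); split; [reflexivity|].
    apply (F_id2 ξ).
  - intros g g' f f' e e' [z [<- <-]] [y [<- <-]].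
    assert (E : @cod W y = @dom W z).
    { apply fp_ext; [|exact e]; simpl.
      exact (eq_trans (eq_trans (f_equal cod (eq_sym (tr_over T1 y))) (F1_composable γ e'))
        (f_equal dom (tr_over T1 z))). }
    exists (@comp1 W z y E); split; [now apply comp1_eq|].
    apply (F_comp1 ξ).
  - intros g g' f f' e e' [z [<- <-]] [y [<- <-]].
    assert (E : @vcod W y = @vdom W z).
    { apply fp_ext; [|exact e]; simpl.
      exact (eq_trans (eq_trans (f_equal vcod (eq_sym (tr_over T2 y))) (F2_vcomposable γ e'))
        (f_equal vdom (tr_over T2 z))). }
    exists (@vcomp W z y E); split; [now apply vcomp_eq|].
    apply (F_vcomp ξ).
  - intros g g' f f' e e' [z [<- <-]] [y [<- <-]].
    assert (E : @cod W (@vdom W y) = @dom W (@vdom W z)).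
    { apply fp_ext; [|exact e]; simpl.
      exact (eq_trans (eq_trans (f_equal (fun a => cod (vdom a)) (eq_sym (tr_over T2 y)))
        (F2_hcomposable γ e')) (f_equal (fun a => dom (vdom a)) (tr_over T2 z))). }
    exists (@hcomp W z y E); split; [now apply hcomp_eq|].
    apply (F_hcomp ξ).
  (* The images of the three 2-cells in [B] form a composable triple, which lifts to [C]; the
     2-cells are transported to these lifts. Their adjacent boundaries are then related and lie over
     the same 1-cell of [C], hence are equal. *)
  - intros c b a e1 e2.
    assert (d1 : vcod (F2 p (F2 γ a)) = vdom (F2 p (F2 γ b)))
      by (rewrite F_vcod, F_vdom, F_vcod, F_vdom; exact (transported_fibre T1 e1)).
    assert (d2 : vcod (F2 p (F2 γ b)) = vdom (F2 p (F2 γ c)))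
      by (rewrite F_vcod, F_vdom, F_vcod, F_vdom; exact (transported_fibre T1 e2)).
    destruct (vs_triple Hp d1 d2) as (c' & b' & a' & h1 & h2 & Hc & Hb & Ha).
    destruct (transported_exists T2 Ha) as (x & Hx & <-).
    destruct (transported_exists T2 Hb) as (y & Hy & <-).
    destruct (transported_exists T2 Hc) as (z & Hz & <-).
    assert (Hglue : forall u v u' v', R2 u u' -> R2 v v' ->
      R1 (vcod u) (vdom v) -> vcod (F2 γ u') = vdom (F2 γ v') ->
      vcod u' = vdom v').
    { intros u v u' v' Hu Hv Huv; rewrite F_vcod, F_vdom.
      apply (transported_eq T1).
      apply (equiv_trans E1 (equiv_sym E1 (Hvcod _ _ Hu))).
      exact (equiv_trans E1 Huv (Hvdom _ _ Hv)). }
    exists z, y, x; repeat split.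
    + exact (Hglue _ _ _ _ Hx Hy e1 h1).
    + exact (Hglue _ _ _ _ Hy Hz e2 h2).
    + exact (equiv_sym E2 Hz).
    + exact (equiv_sym E2 Hy).
    + exact (equiv_sym E2 Hx).
Qed.

Notation q := (quotient_map transported_congruence).

Lemma quotient_transported_arr z : F1 q (F1 ξ z) = F1 q (fp2 z).
Proof.
  apply quotient_map_arr, (equiv_sym (transported_equivalence T1)); now exists z.
Qed.

Lemma quotient_transported_cell z : F2 q (F2 ξ z) = F2 q (fp2 z).
Proof.
  apply quotient_map_cell, (equiv_sym (transported_equivalence T2)); now exists z.
Qed.

(** The comparison with the pullback is injective by [transported_eq] and surjective by
    [transported_exists], on 1-cells and on 2-cells; on objects [p] is injective and [q] the
    identity. *)
Lemma quotient_descends : exists (π : TwoFunctor (quotient transported_congruence) B)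
  (e : two_functor_comp p γ = two_functor_comp π q),
  is_iso (two_pullback_pair e : @Hom TwoCat _ _).
Proof.
  pose proof (quotient_map_vertically_surjective transported_congruence) as Hq.
  destruct (vs_descend Hq (G := two_functor_comp p γ)) as [π Hπ].
  - intros f f' e%quotient_map_arr; exact (transported_fibre T1 e).
  - intros a a' e%quotient_map_cell; exact (transported_fibre T2 e).
  - exists π, (eq_sym Hπ); apply bijective_iso; simpl.
    + intros x x' e; exact (f_equal (@fp2 _ _ _ _ _) e).
    + intros z; exists (fp2 z); apply fp_ext; [|reflexivity].
      apply (vs_obj_inj Hp).
      exact (eq_trans (f_equal (fun G => F0 G (fp2 z)) (eq_sym Hπ)) (eq_sym (fp_square z))).
    + intros f f' e.
      apply (transported_eq T1); [|exact (f_equal (@fp1 _ _ _ _ _) e)].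
      exact (proj1 (quotient_map_arr transported_congruence _ _) (f_equal (@fp2 _ _ _ _ _) e)).
    + intros z; destruct (vs_arr Hq (fp2 z)) as [f Hf].
      destruct (transported_exists T1 (c := fp1 z) (x := f)) as (f' & H1 & H2).
      { rewrite fp_square, <- Hf; exact (f_equal (fun G => F1 G f) Hπ). }
      exists f'; apply fp_ext; [exact H2|].
      transitivity (F1 q f); [|exact Hf].
      now apply quotient_map_arr, (equiv_sym (transported_equivalence T1)).
    + intros f f' e.
      apply (transported_eq T2); [|exact (f_equal (@fp1 _ _ _ _ _) e)].
      exact (proj1 (quotient_map_cell transported_congruence _ _) (f_equal (@fp2 _ _ _ _ _) e)).
    + intros z; destruct (vs_cell Hq (fp2 z)) as [f Hf].
      destruct (transported_exists T2 (c := fp1 z) (x := f)) as (f' & H1 & H2).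
      { rewrite fp_square, <- Hf; exact (f_equal (fun G => F2 G f) Hπ). }
      exists f'; apply fp_ext; [exact H2|].
      transitivity (F2 q f); [|exact Hf].
      now apply quotient_map_cell, (equiv_sym (transported_equivalence T2)).
Qed.

End Algebra.

Section AlgebraFunctor.
Context (X : TwoCategory) (γ : TwoFunctor X C)
  (ξ : TwoFunctor (two_pullback p (two_functor_comp p γ)) X).

Notation W := (two_pullback p (two_functor_comp p γ)).

(** The algebra laws, read on objects, 1-cells and 2-cells, are three instances of [transport]. The
    squares are hypotheses, so that their proofs can be taken from the general criterion. *)
Lemma vs_algebra_descends
  (e1 : two_functor_comp γ ξ = two_pullback_fst p (two_functor_comp p γ))
  (S0 : two_functor_comp p γ = two_functor_comp (two_functor_comp p γ) (two_functor_id X))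
  (S1 : two_functor_comp p (two_pullback_fst p
      (two_functor_comp p (two_pullback_fst p (two_functor_comp p γ)))) =
    two_functor_comp (two_functor_comp p γ)
      (two_functor_comp (two_pullback_snd p (two_functor_comp p γ))
        (two_pullback_snd p
          (two_functor_comp p (two_pullback_fst p (two_functor_comp p γ))))))
  (S2 : two_functor_comp p (two_pullback_fst p
      (two_functor_comp p (two_pullback_fst p (two_functor_comp p γ)))) =
    two_functor_comp (two_functor_comp p γ)
      (two_functor_comp ξ
        (two_pullback_snd p
          (two_functor_comp p (two_pullback_fst p (two_functor_comp p γ))))))
  (e2 : two_functor_comp ξ (two_pullback_pair S0) = two_functor_id X)
  (e3 : two_functor_comp ξ (two_pullback_pair S1) =
    two_functor_comp ξ (two_pullback_pair S2)) :
  exists (Y : TwoCategory) (π : TwoFunctor Y B) (q : TwoFunctor X Y)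
    (e : two_functor_comp p γ = two_functor_comp π q),
    two_functor_comp q ξ = two_functor_comp q (two_pullback_snd p (two_functor_comp p γ)) /\
    is_iso (two_pullback_pair e : @Hom TwoCat _ _).
Proof.
  assert (T0 : transport (p := F0 p) (γ := F0 γ) (F0 ξ)).
  { split.
    - exact (fun z => f_equal (fun G : TwoFunctor W C => F0 G z) e1).
    - intros z e; etransitivity; [|exact (f_equal (fun G : TwoFunctor X X => F0 G (fp2 z)) e2)].
      simpl; f_equal; now apply fp_ext.
    - intros z z' z'' H1 H2 H3.
      assert (k : F0 p (fp1 z') = F0 p (fp1 z)).
      { rewrite (fp_square z'), H1; f_equal.
        exact (f_equal (fun G : TwoFunctor W C => F0 G z) e1). }
      (* The point [(fp1 z', z)] of the iterated pullback: multiplication sends it to [z''],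
         applying [ξ] to its second component gives [z'], and [e3] equates the results. The same
         point serves for 1-cells and 2-cells below. *)
      set (w := fp (f := F0 p)
        (g := F0 (two_functor_comp p (two_pullback_fst p (two_functor_comp p γ))))
        (x := fp1 z') (y := z) k).
      pose proof (f_equal (fun G : TwoFunctor (two_pullback p (two_functor_comp p
        (two_pullback_fst p (two_functor_comp p γ)))) X => F0 G w) e3) as e.
      transitivity (F0 ξ (F0 (two_pullback_pair S2) w)); [f_equal; now apply fp_ext|].
      transitivity (F0 ξ (F0 (two_pullback_pair S1) w)); [exact (eq_sym e)|].
      f_equal; now apply fp_ext. }
  assert (T1 : transport (p := F1 p) (γ := F1 γ) (F1 ξ)).
  { split.
    - exact (fun z => f_equal (fun G : TwoFunctor W C => F1 G z) e1).
    - intros z e; etransitivity; [|exact (f_equal (fun G : TwoFunctor X X => F1 G (fp2 z)) e2)].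
      simpl; f_equal; now apply fp_ext.
    - intros z z' z'' H1 H2 H3.
      assert (k : F1 p (fp1 z') = F1 p (fp1 z)).
      { rewrite (fp_square z'), H1; f_equal.
        exact (f_equal (fun G : TwoFunctor W C => F1 G z) e1). }
      set (w := fp (f := F1 p)
        (g := F1 (two_functor_comp p (two_pullback_fst p (two_functor_comp p γ))))
        (x := fp1 z') (y := z) k).
      pose proof (f_equal (fun G : TwoFunctor (two_pullback p (two_functor_comp p
        (two_pullback_fst p (two_functor_comp p γ)))) X => F1 G w) e3) as e.
      transitivity (F1 ξ (F1 (two_pullback_pair S2) w)); [f_equal; now apply fp_ext|].
      transitivity (F1 ξ (F1 (two_pullback_pair S1) w)); [exact (eq_sym e)|].
      f_equal; now apply fp_ext. }
  assert (T2 : transport (p := F2 p) (γ := F2 γ) (F2 ξ)).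
  { split.
    - exact (fun z => f_equal (fun G : TwoFunctor W C => F2 G z) e1).
    - intros z e; etransitivity; [|exact (f_equal (fun G : TwoFunctor X X => F2 G (fp2 z)) e2)].
      simpl; f_equal; now apply fp_ext.
    - intros z z' z'' H1 H2 H3.
      assert (k : F2 p (fp1 z') = F2 p (fp1 z)).
      { rewrite (fp_square z'), H1; f_equal.
        exact (f_equal (fun G : TwoFunctor W C => F2 G z) e1). }
      set (w := fp (f := F2 p)
        (g := F2 (two_functor_comp p (two_pullback_fst p (two_functor_comp p γ))))
        (x := fp1 z') (y := z) k).
      pose proof (f_equal (fun G : TwoFunctor (two_pullback p (two_functor_comp p
        (two_pullback_fst p (two_functor_comp p γ)))) X => F2 G w) e3) as e.
      transitivity (F2 ξ (F2 (two_pullback_pair S2) w)); [f_equal; now apply fp_ext|].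
      transitivity (F2 ξ (F2 (two_pullback_pair S1) w)); [exact (eq_sym e)|].
      f_equal; now apply fp_ext. }
  destruct (quotient_descends T0 T1 T2) as (π & e & He).
  exists (quotient (transported_congruence T0 T1 T2)), π,
    (quotient_map (transported_congruence T0 T1 T2)), e.
  split; [|exact He].
  apply two_functor_eq; simpl; intros z.
  - exact (transport_obj T0 z).
  - exact (quotient_transported_arr T0 T1 T2 z).
  - exact (quotient_transported_cell T0 T1 T2 z).
Qed.

End AlgebraFunctor.

Lemma vs_algebras_descend : algebras_descend P p.
Proof.
  intros X γ ξ e1 e2 e3; exact (vs_algebra_descends e1 e2 e3).
Qed.

Lemma vs_effective_descent : is_effective_descent P p.
Proof.
  apply effective_descent_intro.
  - intros Y π; exact (vs_epi (vs_pullback π Hp)).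
  - exact vs_pullbacks_coequalize.
  - exact vs_algebras_descend.
Qed.

End Descent.

(** * A covering by a 2-preorder *)

Lemma vcomp_idl_eq (B : TwoCategory) (b a : cell B) e : b = id2 (vcod a) -> vcomp b a e = a.
Proof. intros ->; apply vcomp_idl. Qed.

Lemma vcomp_idr_eq (B : TwoCategory) (b a : cell B) e : a = id2 (vdom b) -> vcomp b a e = b.
Proof. intros ->; apply vcomp_idr. Qed.

Lemma hcomp_idl_eq (B : TwoCategory) (b a : cell B) e :
  b = id2 (id1 (cod (vdom a))) -> hcomp b a e = a.
Proof. intros ->; apply hcomp_idl. Qed.

Lemma hcomp_idr_eq (B : TwoCategory) (b a : cell B) e :
  a = id2 (id1 (dom (vdom b))) -> hcomp b a e = b.
Proof. intros ->; apply hcomp_idr. Qed.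

Section Cover.
Context (B : TwoCategory).

(* The vertical composites [s (j-1) ∘ ... ∘ s i]. *)
Inductive segment (s : nat -> cell B) (i : nat) : nat -> cell B -> Prop :=
| segment_refl : segment s i i (id2 (vdom (s i)))
| segment_step j b (e : vcod b = vdom (s j)) :
    segment s i j b -> vcod (s j) = vdom (s (S j)) ->
    segment s i (S j) (vcomp (s j) b e).

Lemma segment_le s i j b : segment s i j b -> i <= j.
Proof. induction 1; lia. Qed.

Lemma segment_vdom s i j b : segment s i j b -> vdom b = vdom (s i).
Proof. induction 1; [apply vdom_id2 | now rewrite vdom_vcomp]. Qed.

Lemma segment_vcod s i j b : segment s i j b -> vcod b = vdom (s j).
Proof. induction 1; [apply vcod_id2 | now rewrite vcod_vcomp]. Qed.

(** Each step raises the index by one, so the end points fix the number of steps. Thinness of the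
    cover rests on this. *)
Lemma segment_unique s i j b b' : segment s i j b -> segment s i j b' -> b = b'.
Proof.
  intros H; revert b'; induction H as [|j b e H IH Hs]; intros b' H'.
  - inversion H' as [|j' c e' H1 Hs']; [reflexivity|].
    apply segment_le in H1; lia.
  - inversion H' as [Hij|j' c e' H1 Hs' Hj].
    + subst; apply segment_le in H; lia.
    + subst; apply vcomp_eq; auto.
Qed.

Lemma segment_vcomp s i j k a b (e : vcod a = vdom b) :
  segment s i j a -> segment s j k b -> segment s i k (vcomp b a e).
Proof.
  intros Ha H; revert e; induction H as [|k b e' H IH Hs]; intros e.
  - pose proof (segment_vcod Ha) as Hv; revert e; rewrite <- Hv; intros e.
    now rewrite vcomp_idl.
  - assert (e1 : vcod a = vdom b) by (now rewrite vdom_vcomp in e).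
    assert (e2 : vcod (vcomp b a e1) = vdom (s k)) by (now rewrite vcod_vcomp).
    rewrite <- (vcomp_assoc e2 e); apply segment_step; auto.
Qed.

(** A letter [(s, i)] is the [i]-th point of the sequence [s] and stands for the 1-cell
    [vdom (s i)]. The head of a word is the factor applied last. *)
Definition word : Type := list ((nat -> cell B) * nat).

(* A cell of [B] is evaluated from a horizontal string of segments; the two words
   record the strings of its end points. *)
Inductive eval : word -> word -> cell B -> Prop :=
| eval_nil x : eval nil nil (id2 (id1 x))
| eval_cons s i j w w' c b (e : cod (vdom b) = dom (vdom c)) :
    segment s i j c -> eval w w' b ->
    eval ((s, i) :: w) ((s, j) :: w') (hcomp c b e).

(** Words determine their value except for the object at the empty tail; as the domain of a
    composite is that of its tail, the last hypothesis fixes this object. *)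
Lemma eval_unique w w' b b' : eval w w' b -> eval w w' b' ->
  dom (vdom b) = dom (vdom b') -> b = b'.
Proof.
  intros H; revert b'; induction H as [x|s i j w w' c b e Hs H IH]; intros b' H' Hd.
  - inversion H'; subst; rewrite !vdom_id2, !dom_id1 in Hd; congruence.
  - inversion H' as [|s' i' j' v v' c' d e' Hs' Hv]; subst.
    rewrite !vdom_hcomp, !dom_comp1 in Hd.
    apply hcomp_eq; [exact (segment_unique Hs Hs') | auto].
Qed.

Lemma hcomp_id2_vdom (c b : cell B) (e : cod (vdom b) = dom (vdom c))
  (e' : cod (vdom (id2 (vdom b))) = dom (vdom (id2 (vdom c)))) :
  id2 (vdom (hcomp c b e)) = hcomp (id2 (vdom c)) (id2 (vdom b)) e'.
Proof. rewrite (hcomp_id2 e' e); f_equal; apply vdom_hcomp. Qed.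

Lemma hcomp_id2_vcod (c b : cell B) (e : cod (vdom b) = dom (vdom c))
  (e' : cod (vdom (id2 (vcod b))) = dom (vdom (id2 (vcod c)))) :
  id2 (vcod (hcomp c b e)) = hcomp (id2 (vcod c)) (id2 (vcod b)) e'.
Proof.
  assert (k : cod (vcod b) = dom (vcod c)) by (now rewrite cod_vcod, dom_vcod).
  rewrite (hcomp_id2 e' k); f_equal; apply vcod_hcomp.
Qed.

Lemma eval_vdom w w' b : eval w w' b -> eval w w (id2 (vdom b)).
Proof.
  induction 1 as [x|s i j w w' c b e Hs H IH].
  - rewrite vdom_id2; apply eval_nil.
  - assert (e' : cod (vdom (id2 (vdom b))) = dom (vdom (id2 (vdom c))))
      by (now rewrite !vdom_id2).
    rewrite (hcomp_id2_vdom e e'); apply eval_cons; [|exact IH].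
    rewrite (segment_vdom Hs); apply segment_refl.
Qed.

Lemma eval_vcod w w' b : eval w w' b -> eval w' w' (id2 (vcod b)).
Proof.
  induction 1 as [x|s i j w w' c b e Hs H IH].
  - rewrite vcod_id2; apply eval_nil.
  - assert (e' : cod (vdom (id2 (vcod b))) = dom (vdom (id2 (vcod c))))
      by (now rewrite !vdom_id2, cod_vcod, dom_vcod).
    rewrite (hcomp_id2_vcod e e'); apply eval_cons; [|exact IH].
    rewrite (segment_vcod Hs); apply segment_refl.
Qed.

Lemma eval_hcomp v v' w w' c b (e : cod (vdom b) = dom (vdom c)) :
  eval v v' c -> eval w w' b -> eval (v ++ w) (v' ++ w') (hcomp c b e).
Proof.
  intros H Hb; revert e; induction H as [x|s i j v v' d c e' Hs H IH]; intros e.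
  - assert (Hx : x = cod (vdom b)) by (now rewrite e, vdom_id2, dom_id1).
    revert e; rewrite Hx; intros e; now rewrite hcomp_idl.
  - assert (e1 : cod (vdom b) = dom (vdom c)) by (now rewrite vdom_hcomp, dom_comp1 in e).
    assert (e2 : cod (vdom (hcomp c b e1)) = dom (vdom d))
      by (now rewrite vdom_hcomp, cod_comp1).
    rewrite <- (hcomp_assoc e2 e); apply eval_cons; auto.
Qed.

(** By interchange, strings compose letter by letter, each pair of letters by concatenating segments
    of the same sequence. *)
Lemma eval_vcomp w w' w'' b a (e : vcod a = vdom b) :
  eval w w' a -> eval w' w'' b -> eval w w'' (vcomp b a e).
Proof.
  intros H; revert w'' b e; induction H as [x|s i j w w' c a e' Hs H IH];
    intros w'' b e Hb.
  - inversion Hb; subst.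
    assert (Hx : x = x0) by (apply (f_equal dom) in e;
      now rewrite vcod_id2, vdom_id2, !dom_id1 in e).
    subst; rewrite vcomp_idl_eq; [apply eval_nil | now rewrite vcod_id2].
  - inversion Hb as [|s' i' k v v' c' b' e'' Hs' Hb']; subst.
    assert (Hc : vcod c = vdom c')
      by (now rewrite (segment_vcod Hs), (segment_vdom Hs')).
    (* The identities on both 1-cells are values of the same pair of words with the same domain, so
       [eval_unique] applies. *)
    assert (Hab : vcod a = vdom b').
    { pose proof (eval_unique (eval_vcod H) (eval_vdom Hb')) as K.
      rewrite <- (vdom_id2 (vcod a)), K; [apply vdom_id2|].
      rewrite !vdom_id2; apply (f_equal dom) in e.
      now rewrite dom_vcod, !vdom_hcomp, !dom_comp1, <- dom_vcod in e. }
    assert (h : cod (vdom (vcomp b' a Hab)) = dom (vdom (vcomp c' c Hc)))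
      by (now rewrite !vdom_vcomp).
    rewrite <- (interchange h e).
    apply eval_cons; [exact (segment_vcomp _ Hs Hs') | exact (IH _ _ _ Hb')].
Qed.

(** The value in [B] is stored beside the word because the empty word has the identity of every
    object as a value. *)
Definition cover_arr : Type :=
  {wf : word * arr B | eval (fst wf) (fst wf) (id2 (snd wf))}.

Definition cover_cell : Type :=
  {wwb : (word * word) * cell B | eval (fst (fst wwb)) (snd (fst wwb)) (snd wwb)}.

Definition mk_arr w f (H : eval w w (id2 f)) : cover_arr := exist _ (w, f) H.

Definition mk_cell w w' b (H : eval w w' b) : cover_cell := exist _ ((w, w'), b) H.

Definition arr_of (f : cover_arr) : arr B := snd (proj1_sig f).
Definition word_of (f : cover_arr) : word := fst (proj1_sig f).
Definition cell_of (a : cover_cell) : cell B := snd (proj1_sig a).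

Definition cover_vdom (a : cover_cell) : cover_arr := mk_arr (eval_vdom (proj2_sig a)).
Definition cover_vcod (a : cover_cell) : cover_arr := mk_arr (eval_vcod (proj2_sig a)).

Lemma cover_arr_ext (f g : cover_arr) : word_of f = word_of g -> arr_of f = arr_of g -> f = g.
Proof.
  destruct f as [[w f] H], g as [[v g] H']; unfold word_of, arr_of; simpl.
  intros; apply sig_eq; simpl; congruence.
Qed.

Lemma cover_cell_ext (a b : cover_cell) :
  word_of (cover_vdom a) = word_of (cover_vdom b) ->
  word_of (cover_vcod a) = word_of (cover_vcod b) -> cell_of a = cell_of b -> a = b.
Proof.
  destruct a as [[[w w'] a] H], b as [[[v v'] b] H']; unfold word_of, cell_of; simpl.
  intros; apply sig_eq; simpl; congruence.
Qed.

Lemma cover_id1_eval x : eval nil nil (id2 (@id1 B x)).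
Proof. apply eval_nil. Qed.

Lemma cover_comp1_eval (g f : cover_arr) (e : cod (arr_of f) = dom (arr_of g)) :
  eval (word_of g ++ word_of f) (word_of g ++ word_of f) (id2 (comp1 (arr_of g) (arr_of f) e)).
Proof.
  assert (e' : cod (vdom (id2 (arr_of f))) = dom (vdom (id2 (arr_of g))))
    by (now rewrite !vdom_id2).
  rewrite <- (hcomp_id2 e' e); exact (eval_hcomp e' (proj2_sig g) (proj2_sig f)).
Qed.

Lemma cover_vcomposable (b a : cover_cell) :
  cover_vcod a = cover_vdom b -> vcod (cell_of a) = vdom (cell_of b).
Proof. intros e; exact (f_equal arr_of e). Qed.

Lemma cover_vcomp_eval (b a : cover_cell) (e : cover_vcod a = cover_vdom b) :
  eval (word_of (cover_vdom a)) (word_of (cover_vcod b))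
    (vcomp (cell_of b) (cell_of a) (cover_vcomposable e)).
Proof.
  apply eval_vcomp with (w' := word_of (cover_vcod a)); [exact (proj2_sig a)|].
  rewrite e; exact (proj2_sig b).
Qed.

Definition cover : TwoCategory.
Proof.
  refine {| obj := obj B; arr := cover_arr; cell := cover_cell;
    dom := fun f => dom (arr_of f); cod := fun f => cod (arr_of f);
    vdom := cover_vdom; vcod := cover_vcod;
    id1 := fun x => mk_arr (cover_id1_eval x);
    id2 := fun f => @mk_cell (word_of f) (word_of f) (id2 (arr_of f)) (proj2_sig f);
    comp1 := fun g f e => mk_arr (cover_comp1_eval e);
    vcomp := fun b a e => mk_cell (cover_vcomp_eval e);
    hcomp := fun b a e => mk_cell (eval_hcomp e (proj2_sig b) (proj2_sig a)) |}.
  - intros; apply dom_vcod.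
  - intros; apply cod_vcod.
  - intros; apply dom_id1.
  - intros; apply cod_id1.
  - intros; apply dom_comp1.
  - intros; apply cod_comp1.
  - intros; apply cover_arr_ext; [reflexivity | apply comp1_idl].
  - intros; apply cover_arr_ext; [apply app_nil_r | apply comp1_idr].
  - intros; apply cover_arr_ext; [apply app_assoc | apply comp1_assoc].
  - intros; apply cover_arr_ext; [reflexivity | apply vdom_id2].
  - intros; apply cover_arr_ext; [reflexivity | apply vcod_id2].
  - intros; apply cover_arr_ext; [reflexivity | apply vdom_vcomp].
  - intros; apply cover_arr_ext; [reflexivity | apply vcod_vcomp].
  - intros; apply cover_cell_ext; [reflexivity | reflexivity | apply vcomp_idl].
  - intros; apply cover_cell_ext; [reflexivity | reflexivity | apply vcomp_idr].
  - intros; apply cover_cell_ext; [reflexivity | reflexivity | apply vcomp_assoc].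
  - intros; apply cover_arr_ext; [reflexivity | apply vdom_hcomp].
  - intros; apply cover_arr_ext; [reflexivity | apply vcod_hcomp].
  - intros; apply cover_cell_ext; [reflexivity | reflexivity | apply hcomp_idl].
  - intros; apply cover_cell_ext; [apply app_nil_r | apply app_nil_r | apply hcomp_idr].
  - intros; apply cover_cell_ext; [apply app_assoc | apply app_assoc | apply hcomp_assoc].
  - intros; apply cover_cell_ext; [reflexivity | reflexivity | apply hcomp_id2].
  - intros; apply cover_cell_ext; [reflexivity | reflexivity | apply interchange].
Defined.

Lemma cover_two_preorder : is_two_preorder cover.
Proof.
  intros a b e1 e2; apply cover_cell_ext.
  - exact (f_equal word_of e1).
  - exact (f_equal word_of e2).
  - refine (eval_unique (proj2_sig a) _ _).
    + change (eval (word_of (cover_vdom a)) (word_of (cover_vcod a)) (cell_of b)).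
      simpl in e1, e2; rewrite e1, e2; exact (proj2_sig b).
    + exact (f_equal (fun f => dom (arr_of f)) e1).
Qed.

Definition cover_map : TwoFunctor cover B.
Proof.
  refine (@Build_TwoFunctor cover B (fun x => x) arr_of cell_of _ _ _ _ _ _ _ _ _);
    intros; first [reflexivity | apply comp1_eq; reflexivity
      | apply vcomp_eq; reflexivity | apply hcomp_eq; reflexivity].
Defined.

(** A single term of a sequence is a segment of length one; the identities only bring it into the
    form of the constructors. *)
Lemma generator_eval s i (e : vcod (s i) = vdom (s (S i))) :
  eval ((s, i) :: nil) ((s, S i) :: nil) (s i).
Proof.
  assert (e1 : vcod (id2 (vdom (s i))) = vdom (s i)) by apply vcod_id2.
  assert (e2 : cod (vdom (id2 (id1 (dom (vdom (s i)))))) = dom (vdom (s i)))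
    by (now rewrite vdom_id2, cod_id1).
  rewrite <- (hcomp_idr (a := s i) e2).
  apply eval_cons; [|apply eval_nil].
  rewrite <- (vcomp_idr (a := s i) e1).
  apply segment_step; [apply segment_refl | exact e].
Qed.

Lemma cover_map_vertically_surjective : vertically_surjective cover_map.
Proof.
  split; [now intros|]; intros c b a e1 e2.
  (* Consecutive segments of one sequence share end points, so the lifts are composable. The
     identity after [c] is there because a segment may pass a term only if the next one is
     composable with it. *)
  set (s := fun n => match n with 0 => a | 1 => b | 2 => c | _ => id2 (vcod c) end).
  assert (e3 : vcod c = vdom (id2 (vcod c))) by (now rewrite vdom_id2).
  exists (mk_cell (@generator_eval s 2 e3)), (mk_cell (@generator_eval s 1 e2)),
    (mk_cell (@generator_eval s 0 e1)).
  repeat split; apply cover_arr_ext; first [reflexivity | assumption].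
Qed.

End Cover.

(** * Stable and local classes *)

(** The objects are [false] and [true]; [walking_end false] and [walking_end true] are the two
    parallel 1-cells bounding the generating 2-cell. *)
Inductive walking_arr : Type := walking_id (x : bool) | walking_end (x : bool).
Inductive walking_cell : Type := walking_id2 (f : walking_arr) | walking_generator.

Definition walking : TwoCategory.
Proof.
  refine {| obj := bool; arr := walking_arr; cell := walking_cell;
    dom := fun f => match f with walking_id x => x | walking_end _ => false end;
    cod := fun f => match f with walking_id x => x | walking_end _ => true end;
    vdom := fun a => match a with walking_id2 f => f | walking_generator => walking_end false end;
    vcod := fun a => match a with walking_id2 f => f | walking_generator => walking_end true end;
    id1 := walking_id; id2 := walking_id2;
    comp1 := fun g f _ => match g with walking_id _ => f | _ => g end;
    vcomp := fun b a _ => match b with walking_id2 _ => a | _ => b end;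
    hcomp := fun b a _ => match b with walking_id2 (walking_id _) => a | _ => b end |};
  abstract (intros; repeat match goal with
    | f : walking_arr |- _ => destruct f
    | a : walking_cell |- _ => destruct a
    end; simpl in *; congruence).
Defined.

Section Walking.
Context (B : TwoCategory) (b : cell B).

Definition pick0 (x : bool) : obj B := if x then cod (vdom b) else dom (vdom b).
Definition pick1 (f : walking_arr) : arr B :=
  match f with
  | walking_id x => id1 (pick0 x)
  | walking_end x => if x then vcod b else vdom b
  end.
Definition pick2 (a : walking_cell) : cell B :=
  match a with walking_id2 f => id2 (pick1 f) | walking_generator => b end.

Definition pick : TwoFunctor walking B.
Proof.
  refine (@Build_TwoFunctor walking B pick0 pick1 pick2 _ _ _ _ _ _ _ _ _).
  - intros [x|[|]]; simpl; auto using dom_id1, dom_vcod.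
  - intros [x|[|]]; simpl; auto using cod_id1, cod_vcod.
  - intros [f|]; simpl; auto using vdom_id2.
  - intros [f|]; simpl; auto using vcod_id2.
  - reflexivity.
  - reflexivity.
  - intros [x|x] f e e'; simpl in *.
    + symmetry; apply comp1_idl_eq; now rewrite e', dom_id1.
    + destruct f as [y|y]; [|discriminate]; simpl in *.
      symmetry; apply comp1_idr_eq; now rewrite <- e', cod_id1.
  - intros [f|] a e e'; simpl in *.
    + symmetry; apply vcomp_idl_eq; now rewrite e', vdom_id2.
    + destruct a as [f|]; [|discriminate]; simpl in *.
      symmetry; apply vcomp_idr_eq; now rewrite <- e', vcod_id2.
  - intros [[x|x]|] a e e'; simpl in *.
    + symmetry; apply hcomp_idl_eq; now rewrite e', vdom_id2, dom_id1.
    + destruct a as [[y|y]|]; try discriminate; simpl in *.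
      symmetry; apply hcomp_idr_eq; now rewrite <- e', vdom_id2, cod_id1.
    + destruct a as [[y|y]|]; try discriminate; simpl in *.
      symmetry; apply hcomp_idr_eq; now rewrite <- e', vdom_id2, cod_id1.
Defined.

End Walking.

Lemma pick_eq (A B : TwoCategory) (F : TwoFunctor A B) (a : cell A) (b : cell B) :
  F2 F a = b -> two_functor_comp F (pick a) = pick b.
Proof.
  intros <-.
  assert (H0 : forall x, F0 F (pick0 a x) = pick0 (F2 F a) x)
    by (intros [|]; simpl; rewrite F_vdom, ?F_cod, ?F_dom; reflexivity).
  assert (H1 : forall f, F1 F (pick1 a f) = pick1 (F2 F a) f).
  { intros [x|[|]]; simpl; [now rewrite F_id1, H0 | now rewrite F_vcod | now rewrite F_vdom]. }
  apply two_functor_eq; [exact H0 | exact H1 |].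
  intros [f|]; simpl; [now rewrite F_id2, H1 | reflexivity].
Qed.

(* [B] with every 2-cell labelled by an element of the group of order two. *)
Definition doubled (B : TwoCategory) : TwoCategory.
Proof.
  refine {| obj := obj B; arr := arr B; cell := cell B * bool;
    dom := dom; cod := cod; vdom := fun a => vdom (fst a); vcod := fun a => vcod (fst a);
    id1 := id1; id2 := fun f => (id2 f, false); comp1 := comp1;
    vcomp := fun b a e => (vcomp (fst b) (fst a) e, xorb (snd b) (snd a));
    hcomp := fun b a e => (hcomp (fst b) (fst a) e, xorb (snd b) (snd a)) |}.
  - intros; apply dom_vcod.
  - intros; apply cod_vcod.
  - exact (@dom_id1 B).
  - exact (@cod_id1 B).
  - exact (@dom_comp1 B).
  - exact (@cod_comp1 B).
  - exact (@comp1_idl B).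
  - exact (@comp1_idr B).
  - exact (@comp1_assoc B).
  - exact (@vdom_id2 B).
  - exact (@vcod_id2 B).
  - intros; apply vdom_vcomp.
  - intros; apply vcod_vcomp.
  - intros [a x] e; simpl; f_equal; apply vcomp_idl.
  - intros [a x] e; simpl; f_equal; [apply vcomp_idr | now destruct x].
  - intros [c x] [b y] [a z]; intros; simpl; f_equal;
      [apply vcomp_assoc | now destruct x, y, z].
  - intros; apply vdom_hcomp.
  - intros; apply vcod_hcomp.
  - intros [a x] e; simpl; f_equal; apply hcomp_idl.
  - intros [a x] e; simpl; f_equal; [apply hcomp_idr | now destruct x].
  - intros [c x] [b y] [a z]; intros; simpl; f_equal;
      [apply hcomp_assoc | now destruct x, y, z].
  - intros; simpl; f_equal; apply hcomp_id2.
  - intros [d w] [c x] [b y] [a z]; intros; simpl; f_equal; [apply interchange|].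
    now destruct w, x, y, z.
Defined.

Definition doubled_fst (B : TwoCategory) : TwoFunctor (doubled B) B.
Proof.
  refine (@Build_TwoFunctor (doubled B) B (fun x => x) (fun f => f) fst _ _ _ _ _ _ _ _ _);
    intros; first [reflexivity | apply (@comp1_eq B); reflexivity
      | apply (@vcomp_eq B); reflexivity | apply (@hcomp_eq B); reflexivity].
Defined.

(* If [b] is not a value of [p], the two functors [walking -> doubled B] picking
   [(b, true)] and [(b, false)] become equal after pulling back along [p]. *)
Lemma effective_descent_surjective (C B : TwoCat) (p : Hom C B) :
  is_effective_descent TwoCat_pullbacks p -> forall b : cell B, exists c, F2 p c = b.
Proof.
  intros Hp b; apply NNPP; intros Hb.
  pose proof (effective_descent_faithful Hp) as Hf.
  set (x := existT _ walking (pick b) : Slice (C := TwoCat) B).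
  set (y := existT _ (doubled B) (doubled_fst B) : Slice (C := TwoCat) B).
  set (k := fun t => exist _ (pick (B := doubled B) (b, t))
    (pick_eq (F := doubled_fst B) (a := (b, t)) eq_refl) : Hom x y).
  assert (e : k true = k false).
  { apply Hf, sig_eq; simpl; apply two_functor_eq; intros z; apply fp_ext;
      try reflexivity; simpl.
    unfold fp2; simpl.
    destruct z as [[c [f|]] ez]; simpl in *; [reflexivity|].
    exfalso; apply Hb; now exists c. }
  apply (f_equal (@proj1_sig _ _)) in e; simpl in e.
  apply (f_equal (fun F : TwoFunctor walking (doubled B) => F2 F walking_generator)) in e.
  discriminate e.
Qed.

(** * Elementary descriptions of the stabilized and the localized class *)

Record cell_quotient (A B : TwoCategory) (f : TwoFunctor A B) : Prop := {
  cq_inj0 : forall x x', F0 f x = F0 f x' -> x = x';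
  cq_inj1 : forall g g', F1 f g = F1 f g' -> g = g';
  cq_surj2 : forall b, exists a, F2 f a = b
}.

Definition cell_faithful (A B : TwoCategory) (f : TwoFunctor A B) : Prop :=
  forall a a', vdom a = vdom a' -> vcod a = vcod a' -> F2 f a = F2 f a' -> a = a'.

(** Injectivity on 1-cells reflects vertical composability. Through identities, surjectivity on
    2-cells also yields surjectivity on 1-cells and objects. *)
Lemma cell_quotient_vs (A B : TwoCategory) (f : TwoFunctor A B) :
  cell_quotient f -> vertically_surjective f.
Proof.
  intros Hf; split; [exact (cq_inj0 Hf)|].
  intros c b a; destruct (cq_surj2 Hf c) as [c' <-], (cq_surj2 Hf b) as [b' <-],
    (cq_surj2 Hf a) as [a' <-].
  rewrite !F_vcod, !F_vdom; intros e1%(cq_inj1 Hf) e2%(cq_inj1 Hf).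
  now exists c', b', a'.
Qed.

Lemma inverted_intro (A B : TwoCat) (f : Hom A B) :
  cell_quotient f -> inverted reflection_I f.
Proof.
  intros Hf; pose proof (cell_quotient_vs Hf) as Hv.
  assert (Hr : forall r : rcell B, exists s, F2 (reflect_map f) s = r).
  { intros r; destruct (rclass_surj r) as [b <-], (cq_surj2 Hf b) as [a <-].
    exists (rclass a); apply rcell_ext; [symmetry; apply F_vdom | symmetry; apply F_vcod]. }
  apply (bijective_iso (F := reflect_map f)); simpl.
  - exact (cq_inj0 Hf).
  - exact (vs_obj Hv).
  - exact (cq_inj1 Hf).
  - exact (vs_arr Hv).
  - intros r s e; apply rcell_ext; apply (cq_inj1 Hf).
    + exact (f_equal (@rdom B) e).
    + exact (f_equal (@rcod B) e).
  - exact Hr.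
Qed.

(** The reflection remembers only which boundaries are inhabited, so the last clause gives a 2-cell
    with the right boundary but not a preimage of [b]. *)
Lemma inverted_elim (A B : TwoCat) (f : Hom A B) : inverted reflection_I f ->
  (forall x x', F0 f x = F0 f x' -> x = x') /\ (forall y, exists x, F0 f x = y) /\
  (forall g g', F1 f g = F1 f g' -> g = g') /\ (forall g, exists g', F1 f g' = g) /\
  forall g g' b, vdom b = F1 f g -> vcod b = F1 f g' ->
    exists a, vdom a = g /\ vcod a = g'.
Proof.
  intros H.
  destruct (iso_bijective (F := reflect_map f) H) as (i0 & s0 & i1 & s1 & _ & s2).
  simpl in *; repeat split; auto.
  intros g g' b e1 e2; destruct (s2 (rclass b)) as [r er].
  destruct (rclass_surj r) as [a <-].
  exists a; split; apply i1.
  - rewrite <- e1; exact (f_equal (@rdom B) er).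
  - rewrite <- e2; exact (f_equal (@rcod B) er).
Qed.

Local Notation P := TwoCat_pullbacks.

Lemma stabilized_intro (A B : TwoCat) (f : Hom A B) :
  cell_quotient f -> stabilized P (inverted reflection_I) f.
Proof.
  intros Hf C g; apply inverted_intro; split.
  - intros x x' e; apply fp_ext; [exact e|]; apply (cq_inj0 Hf).
    rewrite <- !fp_square; f_equal; exact e.
  - intros x x' e; apply fp_ext; [exact e|]; apply (cq_inj1 Hf).
    rewrite <- !fp_square; f_equal; exact e.
  - intros c; destruct (cq_surj2 Hf (F2 g c)) as [a e].
    exists (fp (eq_sym e)); reflexivity.
Qed.

Lemma stabilized_elim (A B : TwoCat) (f : Hom A B) :
  stabilized P (inverted reflection_I) f -> cell_quotient f.
Proof.
  intros Hf; split.
  - destruct (inverted_elim (Hf B (idm B))) as (i0 & _).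
    intros x x' e.
    set (z := fp (f := F0 (two_functor_id B)) (g := F0 f) (x := F0 f x) (y := x) eq_refl).
    set (z' := fp (f := F0 (two_functor_id B)) (g := F0 f) (x := F0 f x') (y := x') eq_refl).
    exact (f_equal (@fp2 _ _ _ _ _) (i0 z z' e)).
  - destruct (inverted_elim (Hf B (idm B))) as (_ & _ & i1 & _).
    intros x x' e.
    set (z := fp (f := F1 (two_functor_id B)) (g := F1 f) (x := F1 f x) (y := x) eq_refl).
    set (z' := fp (f := F1 (two_functor_id B)) (g := F1 f) (x := F1 f x') (y := x') eq_refl).
    exact (f_equal (@fp2 _ _ _ _ _) (i1 z z' e)).
  (* Over the walking 2-cell the right boundary is enough: the generator is the only 2-cell between
     its ends, so the 2-cell [z] lies over it and its second component over [b]. *)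
  - intros b; destruct (inverted_elim (Hf walking (pick b))) as (_ & _ & _ & s1 & Hfull).
    destruct (s1 (walking_end false)) as [g Hg], (s1 (walking_end true)) as [g' Hg'].
    destruct (Hfull g g' walking_generator (eq_sym Hg) (eq_sym Hg')) as (z & e1 & e2).
    assert (E1 : vdom (fp1 z) = walking_end false) by (rewrite <- Hg, <- e1; reflexivity).
    assert (E2 : vcod (fp1 z) = walking_end true) by (rewrite <- Hg', <- e2; reflexivity).
    exists (fp2 z); rewrite <- (fp_square z).
    destruct (fp1 z) as [w|]; [|reflexivity]; simpl in E1, E2; congruence.
Qed.

Lemma localized_elim (A B : TwoCat) (f : Hom A B) :
  localized P (trivial_covering reflection) f -> cell_faithful f.
Proof.
  intros (C & p & Hp & [_ Htriv]) a a' e1 e2 e.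
  destruct (effective_descent_surjective Hp (F2 f a)) as [c Hc].
  (* With a common first component [c], the parallel 2-cells [z] and [z'] agree under the unit and
     under the first projection. The trivial covering property, tested on the walking 2-cell, makes
     them equal. *)
  set (z := fp (f := F2 p) (g := F2 f) Hc : cell (two_pullback p f)).
  set (z' := fp (f := F2 p) (g := F2 f) (eq_trans Hc e) : cell (two_pullback p f)).
  assert (E1 : vdom z = vdom z') by (apply fp_ext; [reflexivity | exact e1]).
  assert (E2 : vcod z = vcod z') by (apply fp_ext; [reflexivity | exact e2]).
  assert (Er : two_functor_comp (reflect_unit _) (pick z) =
    two_functor_comp (reflect_unit _) (pick z')).
  { rewrite !(pick_eq eq_refl); f_equal; apply rcell_ext; assumption. }
  assert (Ef : two_functor_comp (two_pullback_fst p f) (pick z) =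
    two_functor_comp (two_pullback_fst p f) (pick z')).
  { rewrite !(pick_eq eq_refl); reflexivity. }
  destruct (Htriv walking (two_functor_comp (reflect_unit _) (pick z))
    (two_functor_comp (two_pullback_fst p f) (pick z))) as [w [_ Hw]].
  { pose proof (naturality reflection_unit (two_pullback_fst p f)) as n.
    apply (f_equal (fun F => two_functor_comp F (pick z))) in n.
    etransitivity; [|etransitivity; [exact (eq_sym n)|]]; now apply two_functor_eq. }
  assert (E : pick z = pick z').
  { transitivity w; [symmetry|]; apply Hw; split; auto. }
  apply (f_equal (fun F : TwoFunctor walking (two_pullback p f) =>
    fp2 (F2 F walking_generator))) in E; exact E.
Qed.

Lemma two_preorder_functor_eq (A B : TwoCategory) (F G : TwoFunctor A B) :
  is_two_preorder B -> (forall x, F0 F x = F0 G x) -> (forall f, F1 F f = F1 G f) -> F = G.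
Proof.
  intros HB H0 H1; apply two_functor_eq; auto.
  intros a; apply HB; rewrite ?F_vdom, ?F_vcod; apply H1.
Qed.

(** On 2-preorders the unit is inverted by the counit, which supplies the mediating 2-functor;
    equalities of 2-functors into a 2-preorder need checking only on objects and 1-cells. *)
Lemma trivial_covering_two_preorder (A B : TwoCat) (f : Hom A B) :
  is_two_preorder A -> is_two_preorder B -> trivial_covering reflection f.
Proof.
  intros HA HB; split; [symmetry; exact (naturality reflection_unit f)|].
  simpl; intros Q u v e.
  exists (two_functor_comp (reflect_counit HA) u); split.
  - split.
    + now apply (two_preorder_functor_eq (@reflect_two_preorder A)).
    + apply (two_preorder_functor_eq HB).
      * exact (fun x => f_equal (fun F : TwoFunctor Q (reflect B) => F0 F x) e).
      * exact (fun x => f_equal (fun F : TwoFunctor Q (reflect B) => F1 F x) e).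
  - intros w [<- _]; now apply (two_preorder_functor_eq HA).
Qed.

Lemma localized_intro (A B : TwoCat) (f : Hom A B) :
  cell_faithful f -> localized P (trivial_covering reflection) f.
Proof.
  intros Hf; exists (cover B), (cover_map B); split.
  { apply vs_effective_descent, cover_map_vertically_surjective. }
  apply trivial_covering_two_preorder; [|exact (@cover_two_preorder B)].
  (* The pullback is a 2-preorder: parallel 2-cells have equal components in the cover, so their
     components in [A] are parallel with equal images under [f]. *)
  intros z z' e1 e2.
  assert (E : fp1 z = fp1 z').
  { apply cover_two_preorder.
    - exact (f_equal (@fp1 _ _ _ _ _) e1).
    - exact (f_equal (@fp1 _ _ _ _ _) e2). }
  apply fp_ext; [exact E|]; apply Hf.
  - exact (f_equal (@fp2 _ _ _ _ _) e1).
  - exact (f_equal (@fp2 _ _ _ _ _) e2).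
  - rewrite <- !fp_square; now f_equal.
Qed.

Lemma iso_cell_quotient (A B : TwoCat) (f : Hom A B) : is_iso f -> cell_quotient f.
Proof. intros H; destruct (iso_bijective H) as (i0 & _ & i1 & _ & _ & s2); now split. Qed.

Lemma iso_cell_faithful (A B : TwoCat) (f : Hom A B) : is_iso f -> cell_faithful f.
Proof.
  intros H; destruct (iso_bijective H) as (_ & _ & _ & _ & i2 & _).
  intros a a' _ _; apply i2.
Qed.

(** The middle object is [A] with parallel 2-cells identified when [f] identifies them. As 1-cells
    are kept apart, composability in the quotient is composability in [A]. *)
Lemma cell_factorization (A B : TwoCategory) (f : TwoFunctor A B) :
  exists (C : TwoCategory) (e : TwoFunctor A C) (m : TwoFunctor C B),
    cell_quotient e /\ cell_faithful m /\ f = two_functor_comp m e.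
Proof.
  set (R := fun a a' : cell A => vdom a = vdom a' /\ vcod a = vcod a' /\ F2 f a = F2 f a').
  assert (HR : congruence eq R).
  { split.
    - split; [reflexivity | now symmetry | intros x y z; apply eq_trans].
    - unfold R; split; [tauto | intuition | intros x y z; intuition congruence].
    - congruence.
    - congruence.
    - now intros a a' [H _].
    - now intros a a' [_ [H _]].
    - intros g g' <-; now repeat split.
    - intros; now apply comp1_eq.
    - intros b b' a a' e e' (H1 & H2 & H3) (K1 & K2 & K3); repeat split.
      + now rewrite !vdom_vcomp.
      + now rewrite !vcod_vcomp.
      + rewrite (F_vcomp f e (F2_vcomposable f e)), (F_vcomp f e' (F2_vcomposable f e')).
        now apply vcomp_eq.
    - intros b b' a a' e e' (H1 & H2 & H3) (K1 & K2 & K3); repeat split.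
      + rewrite !vdom_hcomp; now apply comp1_eq.
      + assert (k : cod (vcod a) = dom (vcod b)) by (now rewrite cod_vcod, dom_vcod).
        assert (k' : cod (vcod a') = dom (vcod b')) by (now rewrite cod_vcod, dom_vcod).
        rewrite (vcod_hcomp e k), (vcod_hcomp e' k'); now apply comp1_eq.
      + rewrite (F_hcomp f e (F2_hcomposable f e)), (F_hcomp f e' (F2_hcomposable f e')).
        now apply hcomp_eq.
    - intros c b a e1 e2; exists c, b, a; now repeat split. }
  pose proof (quotient_map_vertically_surjective HR) as Hq.
  destruct (vs_descend Hq (G := f)) as [m Hm].
  - intros g g' e%(quotient_map_arr HR); now f_equal.
  - intros a a' e%(quotient_map_cell HR); apply e.
  - exists (quotient HR), (quotient_map HR), m; split; [|split; [|now symmetry]].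
    + split; [now intros | | exact (vs_cell Hq)].
      intros g g' e; exact (proj1 (quotient_map_arr HR g g') e).
    + intros b b'; destruct (vs_cell Hq b) as [a <-], (vs_cell Hq b') as [a' <-].
      rewrite !F_vdom, !F_vcod; intros e1%(quotient_map_arr HR) e2%(quotient_map_arr HR) e.
      apply (quotient_map_cell HR); repeat split; try assumption.
      rewrite <- Hm; exact e.
Qed.

Theorem theorem5p3 :
  has_monotone_light_factorization TwoCat_pullbacks reflection.
Proof.
  split.
  - intros A B f Hf; now apply stabilized_intro, iso_cell_quotient.
  - intros A B f Hf; now apply localized_intro, iso_cell_faithful.
  - intros A B C g f Hf%stabilized_elim Hg%stabilized_elim; apply stabilized_intro; split.
    + intros x x' e; apply (cq_inj0 Hf), (cq_inj0 Hg), e.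
    + intros x x' e; apply (cq_inj1 Hf), (cq_inj1 Hg), e.
    + intros c; destruct (cq_surj2 Hg c) as [b <-], (cq_surj2 Hf b) as [a <-].
      now exists a.
  - intros A B C g f Hf%localized_elim Hg%localized_elim; apply localized_intro.
    intros a a' e1 e2 e; apply Hf; [assumption..|].
    apply Hg; [rewrite !F_vdom; now f_equal | rewrite !F_vcod; now f_equal | exact e].
  - intros A B f; destruct (cell_factorization f) as (C & e & m & He & Hm & H).
    exists C, e, m; split; [|split].
    + now apply stabilized_intro.
    + now apply localized_intro.
    + exact H.
  - intros A B C D e m u v He%stabilized_elim Hm%localized_elim Hsq.
    pose proof (cell_quotient_vs He) as Hv.
    (* The diagonal is [u] descended along [e]: if [e] identifies two 2-cells, their images under
       [u] are parallel and agree under [m], hence are equal. *)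
    destruct (vs_descend Hv (G := u)) as [w Hw].
    + intros g g' H%(cq_inj1 He); now f_equal.
    + intros a a' H; apply Hm.
      * rewrite !F_vdom; f_equal; apply (cq_inj1 He); rewrite <- !F_vdom; now f_equal.
      * rewrite !F_vcod; f_equal; apply (cq_inj1 He); rewrite <- !F_vcod; now f_equal.
      * transitivity (F2 v (F2 e a));
          [exact (f_equal (fun F : TwoFunctor A D => F2 F a) Hsq)|].
        rewrite H; exact (f_equal (fun F : TwoFunctor A D => F2 F a') (eq_sym Hsq)).
    + exists w; split.
      * split; [exact Hw|]; apply (vs_epi Hv).
        etransitivity; [|exact Hsq]; etransitivity; [|exact (f_equal (two_functor_comp m) Hw)].
        now apply two_functor_eq.
      * intros w' [Hw' _]; apply (vs_epi Hv); etransitivity; [exact Hw | now symmetry].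
Qed.
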